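(* Let $k\in\mathbb{Z}$. For each $A=\begin{pmatrix}\alpha&\beta\\0&0\end{pmatrix}\in\mathrm{aff}(\mathbb{C})$ and each compactly supported $C^\infty$-function $f\in C_0^\infty(\mathbb{C}\times\mathbf{H}_k)$ of the variables $(\xi,w)$, the operator $\hat\ell_A^{(k)}:=\mathcal F_z\circ\ell_A^{(k)}\circ\mathcal F_z^{-1}$ is given by $$\hat\ell_A^{(k)}(f)=\alpha\left(\tfrac12\partial_w-\partial_{\overline\xi}\right)f+\overline\alpha\left(\tfrac12\partial_{\overline w}-\partial_\xi\right)f+\tfrac i2\left(\beta e^{w-\frac12\overline\xi}+\overline\beta e^{\overline w-\frac12\xi}\right)f .$$
   Context: $\mathrm{aff}(\mathbb{C})$ is the Lie algebra of matrices $A=\begin{pmatrix}\alpha&\beta\\0&0\end{pmatrix}$, $\alpha,\beta\in\mathbb{C}$. For $k\in\mathbb{Z}$, $\mathbf{H}_k=\{w=q_1+iq_2\in\mathbb{C}: q_1\in\mathbb{R},\ 2k\pi<q_2<2k\pi+2\pi\}$. Write $z=p_1+ip_2$, $w=q_1+iq_2$, $\xi=\xi_1+i\xi_2$; $\partial_z=\frac12(\partial_{p_1}-i\partial_{p_2})$, $\partial_{\overline z}=\frac12(\partial_{p_1}+i\partial_{p_2})$, and similarly $\partial_w,\partial_{\overline w},\partial_\xi,\partial_{\overline\xi}$. On $\mathbb{C}\times\mathbf{H}_k$ with coordinates $(z,w)$ the Hamiltonian function of $A$ is $$\widetilde A(z,w)=\tfrac12\left[\alpha z+\beta e^{w}+\overline\alpha\,\overline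 z+\overline\beta e^{\overline w}\right].$$ Put $(x^1,x^2,x^3,x^4)=(p_1,q_1,p_2,q_2)$ and let $\wedge^{ij}$ be the constant antisymmetric matrix whose only nonzero entries are $\wedge^{12}=1$, $\wedge^{21}=-1$, $\wedge^{34}=-1$, $\wedge^{43}=1$. For smooth complex-valued functions $f,g$ set $P^0(f,g)=fg$ and, for $r\ge1$, $$P^r(f,g)=\sum\wedge^{i_1j_1}\cdots\wedge^{i_rj_r}\,\partial_{x^{i_1}}\cdots\partial_{x^{i_r}}f\;\,\partial_{x^{j_1}}\cdots\partial_{x^{j_r}}g$$ (sum over all indices in $\{1,2,3,4\}$). The Moyal product is $f\star g=\sum_{r\ge0}\frac1{r!}\left(\frac1{2i}\right)^rP^r(f,g)$, and $\ell_A^{(k)}$ is left $\star$-multiplication by $i\widetilde A$: $\ell_A^{(k)}(g)=i\widetilde A\star g$. The partial Fourier transform in $z$ and its inverse are $$\mathcal F_z(g)(\xi,w)=\frac1{2\pi}\iint_{\mathbb{R}^2}e^{-i\mathrm{Re}(\xi\overline z)}g(z,w)\,dp_1dp_2,\qquad \mathcal F_z^{-1}(f)(z,w)=\frac1{2\pi}\iint_{\mathbb{R}^2}e^{i\mathrm{Re}(\xi\overline z)}f(\xi,w)\,d\xi_1d\xi_2 .$$ The expression $\mathcal F_z(i\widetilde A\star\mathcal F_z^{-1}(f))$ is understood as the termwise transform $i\sum_{r\ge0}\frac1{r!}\left(\frac1{2i}\right)^r\mathcal F_z\big(P^r(\widetilde A,\mathcal F_z^{-1}(f))\big)$. *)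

(* Defs.v *)
From HB Require Import structures.
From mathcomp Require Import all_boot all_order all_algebra.
From mathcomp Require Import all_classical all_reals all_analysis.
From mathcomp Require Import complex.

Set Implicit Arguments.
Unset Strict Implicit.
Unset Printing Implicit Defensive.

Import Order.TTheory GRing.Theory Num.Theory.
Import numFieldNormedType.Exports.

Local Open Scope classical_set_scope.
Local Open Scope ring_scope.
Local Open Scope complex_scope.

(* C x C is modelled on 'rV[R]_4 through the real coordinates
   (x^1, x^2, x^3, x^4) = (p_1, q_1, p_2, q_2), indexed from 0.
   Functions of (xi, w) use the same layout: (xi_1, q_1, xi_2, q_2). *)
Definition coord1 (R : realType) (x : 'rV[R]_4) : R[i] := x 0 0 +i* x 0 2%R.
Definition coord2 (R : realType) (x : 'rV[R]_4) : R[i] := x 0 1 +i* x 0 3%R.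

Definition point (R : realType) (z w : R[i]) : 'rV[R]_4 :=
  \row_(j < 4) [:: complex.Re z; complex.Re w; complex.Im z; complex.Im w]`_j.

(* C x H_k *)
Definition CH (R : realType) (k : int) : set 'rV[R]_4 :=
  [set x | 2 * k%:~R * pi < complex.Im (coord2 x) < 2 * k%:~R * pi + 2 * pi].

Definition aff (R : realType) : set 'M[R[i]]_2 :=
  [set A | A 1 0 = 0 /\ A 1 1 = 0].

Definition cexp (R : realType) (z : R[i]) : R[i] :=
  (expR (complex.Re z))%:C * (cos (complex.Im z) +i* sin (complex.Im z)).

Definition pder (R : realType) (j : 'I_4) (f : 'rV[R]_4 -> R[i]) :
    'rV[R]_4 -> R[i] :=
  fun x => 'D_(delta_mx 0 j) (fun y => complex.Re (f y)) x
       +i* 'D_(delta_mx 0 j) (fun y => complex.Im (f y)) x.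

Definition pders (R : realType) (s : seq 'I_4) (f : 'rV[R]_4 -> R[i]) :
    'rV[R]_4 -> R[i] :=
  foldr (@pder R) f s.

(* C^oo on U (meant for U open): the partial derivatives of all orders exist
   and are continuous at the points of U. *)
Definition smooth_on (R : realType) (U : set 'rV[R]_4)
    (f : 'rV[R]_4 -> R[i]) : Prop :=
  forall (s : seq 'I_4) (x : 'rV[R]_4), U x ->
    [/\ {for x, continuous (fun y => complex.Re (pders s f y))},
        {for x, continuous (fun y => complex.Im (pders s f y))},
        forall j : 'I_4,
          derivable (fun y => complex.Re (pders s f y)) x (delta_mx 0 j) &
        forall j : 'I_4,
          derivable (fun y => complex.Im (pders s f y)) x (delta_mx 0 j)].

(* C_0^oo(U), its elements being extended by zero outside U. *)
Definition test_function (R : realType) (U : set 'rV[R]_4)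
    (f : 'rV[R]_4 -> R[i]) : Prop :=
  let supp := closure [set x | f x != 0] in
  [/\ smooth_on U f, compact supp & supp `<=` U].

(* Wirtinger derivatives; d1 is d/dz (or d/dxi), d2 is d/dw. *)
Definition d1 (R : realType) (f : 'rV[R]_4 -> R[i]) (x : 'rV[R]_4) : R[i] :=
  2^-1 * (pder 0 f x - 'i%C * pder 2%R f x).
Definition d1bar (R : realType) (f : 'rV[R]_4 -> R[i]) (x : 'rV[R]_4) : R[i] :=
  2^-1 * (pder 0 f x + 'i%C * pder 2%R f x).
Definition d2 (R : realType) (f : 'rV[R]_4 -> R[i]) (x : 'rV[R]_4) : R[i] :=
  2^-1 * (pder 1 f x - 'i%C * pder 3%R f x).
Definition d2bar (R : realType) (f : 'rV[R]_4 -> R[i]) (x : 'rV[R]_4) : R[i] :=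
  2^-1 * (pder 1 f x + 'i%C * pder 3%R f x).

Definition hamiltonian (R : realType) (A : 'M[R[i]]_2) (x : 'rV[R]_4) : R[i] :=
  let z := coord1 x in let w := coord2 x in
  2^-1 * (A 0 0 * z + A 0 1 * cexp w
          + (A 0 0)^*%C * z^*%C + (A 0 1)^*%C * cexp w^*%C).

Definition wedge (R : realType) : 'M[R[i]]_4 :=
  \matrix_(i, j) match nat_of_ord i, nat_of_ord j with
                 | 0%N, 1%N => 1
                 | 1%N, 0%N => -1
                 | 2%N, 3%N => -1
                 | 3%N, 2%N => 1
                 | _, _ => 0
                 end.

(* For r = 0 the only tuples are empty and the formula reads f x * g x. *)
Definition Pr (R : realType) (r : nat) (f g : 'rV[R]_4 -> R[i])
    (x : 'rV[R]_4) : R[i] :=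
  \sum_(I : r.-tuple 'I_4) \sum_(J : r.-tuple 'I_4)
    (\prod_(s < r) wedge R (tnth I s) (tnth J s)) * pders I f x * pders J g x.

Definition cintegrable (R : realType) (g : R[i] -> R[i]) : Prop :=
  let mu := (@lebesgue_measure R \x @lebesgue_measure R)%E in
  mu.-integrable setT (fun p => (complex.Re (g (p.1 +i* p.2)))%:E) /\
  mu.-integrable setT (fun p => (complex.Im (g (p.1 +i* p.2)))%:E).

Definition cintegral (R : realType) (g : R[i] -> R[i]) : R[i] :=
  let mu := (@lebesgue_measure R \x @lebesgue_measure R)%E in
  (\int[mu]_p complex.Re (g (p.1 +i* p.2)))
  +i* (\int[mu]_p complex.Im (g (p.1 +i* p.2))).

Definition Fz_integrand (R : realType) (g : 'rV[R]_4 -> R[i]) (x : 'rV[R]_4)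
    (z : R[i]) : R[i] :=
  cexp (- ('i%C * (complex.Re (coord1 x * z^*%C))%:C)) * g (point z (coord2 x)).

Definition Fz (R : realType) (g : 'rV[R]_4 -> R[i]) (x : 'rV[R]_4) : R[i] :=
  ((2 * pi)^-1)%:C * cintegral (Fz_integrand g x).

Definition Fz_inv_integrand (R : realType) (f : 'rV[R]_4 -> R[i])
    (x : 'rV[R]_4) (xi : R[i]) : R[i] :=
  cexp ('i%C * (complex.Re (xi * (coord1 x)^*%C))%:C) * f (point xi (coord2 x)).

Definition Fz_inv (R : realType) (f : 'rV[R]_4 -> R[i]) (x : 'rV[R]_4) : R[i] :=
  ((2 * pi)^-1)%:C * cintegral (Fz_inv_integrand f x).

(* Partial sums of F_z (Atilde star F_z^-1 f), transformed term by term;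
   R[i]^o carries the usual topology of the complex numbers. *)
Definition star_partial_sums (R : realType) (A : 'M[R[i]]_2)
    (f : 'rV[R]_4 -> R[i]) (x : 'rV[R]_4) : nat -> R[i]^o :=
  series (fun r : nat => (r`!%:R^-1 * (2 * 'i%C)^-1 ^+ r
                          * Fz (Pr r (hamiltonian A) (Fz_inv f)) x : R[i]^o)).

Definition ell_hat (R : realType) (A : 'M[R[i]]_2) (f : 'rV[R]_4 -> R[i])
    (x : 'rV[R]_4) : R[i] :=
  'i%C * limn (star_partial_sums A f x).

(* All the expressions entering ell_hat A f are meaningful on U: the integrals
   and the series converge and F_z^-1 f is smooth. (Otherwise Rocq's integral,
   derivative and limit take default values.) *)
Definition ell_hat_defined (R : realType) (U : set 'rV[R]_4) (A : 'M[R[i]]_2)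
    (f : 'rV[R]_4 -> R[i]) : Prop :=
  smooth_on U (Fz_inv f) /\
  forall x, U x ->
    [/\ cintegrable (Fz_inv_integrand f x),
        forall r : nat,
          cintegrable (Fz_integrand (Pr r (hamiltonian A) (Fz_inv f)) x) &
        cvgn (star_partial_sums A f x)].

(* Main.v *)
Require Import Defs.
From HB Require Import structures.
From mathcomp Require Import all_boot all_order all_algebra.
From mathcomp Require Import all_classical all_reals all_analysis.
From mathcomp Require Import measurable_realfun complex ring lra.

Set Implicit Arguments.
Unset Strict Implicit.
Unset Printing Implicit Defensive.

Import Order.TTheory GRing.Theory Num.Theory.
Import numFieldNormedType.Exports.

Local Open Scope classical_set_scope.
Local Open Scope ring_scope.
Local Open Scope complex_scope.

(** The operator is computed by moving everything to the Fourier side.  Write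
    F for the partial Fourier transform in z, G for its inverse, and let g = G f.

    - Under G, multiplication of f by the frequency turns into differentiation
      of g, and differentiation of f in xi turns into multiplication of g by z:
      d/dp_1 and d/dp_2 of G f are G (i xi_1 f) and G (i xi_2 f), derivatives in
      w commute with G ([pder_Fz_inv]), and p_1 G f = G (i d/dxi_1 f), likewise
      for p_2 ([coord_Fz_inv], an integration by parts).
    - The Hamiltonian is the sum of a part linear in z and of the two functions
      beta e^w / 2 and its conjugate.  The linear part contributes to P^0, where
      it gives derivatives of f in xi, and to P^1, where it gives derivatives
      in w; it is killed by two differentiations.  Every derivative of e^w is a
      multiple of e^w, and pairing it with the derivatives of g produces a power
      of a single first order operator: the exponential part of P^r maps g to
      beta e^w / 2 times G ((- i conj xi)^r f), plus the analogous term with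
      conj beta, conj w and xi ([hasFz_Pr]).
    - All these functions are combinations, with coefficients depending on w
      only, of functions G h; Fourier inversion F (G h) = h ([Fz_inversion])
      removes both transforms.  What remains is the exponential series with
      argument minus half of conj xi or of xi ([star_terms_cvg]).

    The analysis behind this reduces to one real variable: G is, up to the
    factor 1 / 2 pi, the composition of the Fourier transforms [coord_ft] in
    xi_1 and in xi_2 ([Fz_inv_coord_ft], by Fubini).  A test function is smooth
    with bounded derivatives and has bounded support in both frequencies; the
    class [tube] of such functions is stable under derivatives and under
    multiplication by xi_1 and xi_2, so that each statement about smoothness or
    decay follows from plain bounds.  In particular integrating by parts twice
    in each variable bounds G f by a multiple of
    1 / ((1 + p_1^2) (1 + p_2^2)), which makes all integrals absolutely
    convergent.  Fourier inversion on the line is obtained by inserting the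
    damping factor e^(- eps |s|), whose Fourier transform is the Poisson kernel
    2 eps / (eps^2 + u^2), and letting eps tend to 0. *)

(** * Complex numbers as pairs of reals *)

Section complex_numbers.
Variable R : realType.
Implicit Types z u : R[i].
Local Notation Re := (@complex.Re R).
Local Notation Im := (@complex.Im R).
Local Notation normc := (@Normc.normc R).

Lemma reD z u : Re (z + u) = Re z + Re u. Proof. by case: z; case: u. Qed.
Lemma imD z u : Im (z + u) = Im z + Im u. Proof. by case: z; case: u. Qed.
Lemma reN z : Re (- z) = - Re z. Proof. by case: z. Qed.
Lemma imN z : Im (- z) = - Im z. Proof. by case: z. Qed.
Lemma reM z u : Re (z * u) = Re z * Re u - Im z * Im u.
Proof. by case: z; case: u. Qed.
Lemma imM z u : Im (z * u) = Re z * Im u + Im z * Re u.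
Proof. by case: z; case: u. Qed.
Lemma re_real (a : R) : Re a%:C = a. Proof. by []. Qed.
Lemma im_real (a : R) : Im a%:C = 0. Proof. by []. Qed.

Lemma re_i : Re 'i%C = 0. Proof. by []. Qed.
Lemma im_i : Im 'i%C = 1. Proof. by []. Qed.
Lemma re_conj z : Re z^* = Re z. Proof. by case: z. Qed.
Lemma im_conj z : Im z^* = - Im z. Proof. by case: z. Qed.
Lemma re_pair (a b : R) : Re (a +i* b) = a. Proof. by []. Qed.
Lemma im_pair (a b : R) : Im (a +i* b) = b. Proof. by []. Qed.

(** Rewriting rules that split a complex identity into real ones; the parts of a
    sum, product or conjugate are exposed without unfolding the operations. *)
Definition reimE := (reD, imD, reN, imN, reM, imM, re_real, im_real, re_i, im_i,
  re_conj, im_conj, re_pair, im_pair).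

Lemma reimP z u : Re z = Re u -> Im z = Im u -> z = u.
Proof. by case: z => a b; case: u => c d /= -> ->. Qed.

Lemma re_le_normc z : `|Re z| <= normc z.
Proof.
case: z => a b /=; rewrite -sqrtr_sqr ler_wsqrtr// lerDl; exact: sqr_ge0.
Qed.

Lemma im_le_normc z : `|Im z| <= normc z.
Proof.
case: z => a b /=; rewrite -sqrtr_sqr ler_wsqrtr// lerDr; exact: sqr_ge0.
Qed.

Lemma normc_ge0 z : 0 <= normc z.
Proof. exact: le_trans (normr_ge0 _) (re_le_normc z). Qed.

Lemma normc_le z : normc z <= `|Re z| + `|Im z|.
Proof.
case: z => a b /=; rewrite -[leRHS]ger0_norm ?addr_ge0// -sqrtr_sqr.
rewrite ler_wsqrtr// sqrrD -!normrX !(ger0_norm (sqr_ge0 _)).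
by rewrite -addrA lerD2l lerDr mulrn_wge0 ?mulr_ge0.
Qed.

Lemma normc_real (a : R) : normc a%:C = `|a|.
Proof. by rewrite /= expr0n/= addr0 sqrtr_sqr. Qed.

Lemma complex_normE z : `|z| = (normc z)%:C.
Proof. by rewrite normc_def; case: z. Qed.

Lemma normcD z u : normc (z + u) <= normc z + normc u.
Proof. by rewrite -lecR -complex_normE raddfD /= -!complex_normE ler_normD. Qed.

Definition cis (a : R) : R[i] := cos a +i* sin a.

Lemma normc_cis (a : R) : normc (cis a) = 1.
Proof. by rewrite /= cos2Dsin2 sqrtr1. Qed.

Lemma cis0 : cis 0 = 1.
Proof. by rewrite /cis cos0 sin0. Qed.

Lemma cisD (a b : R) : cis (a + b) = cis a * cis b.
Proof. by apply: reimP; rewrite ?reimE/= ?cosD ?sinD; ring. Qed.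

Lemma cexp_real_imag z : cexp z = (expR (Re z))%:C * cis (Im z).
Proof. by []. Qed.

Lemma cexp_i (a : R) : cexp ('i%C * a%:C) = cis a.
Proof.
rewrite cexp_real_imag !reimE/= !(mul0r, mul1r, subr0, addr0, add0r).
by rewrite ?oppr0 expR0 mul1r.
Qed.

Lemma cexp0 : cexp 0 = 1 :> R[i].
Proof. by rewrite cexp_real_imag/= expR0 cis0 mulr1. Qed.

Lemma cexpD z u : cexp (z + u) = cexp z * cexp u.
Proof.
rewrite !cexp_real_imag !reimE expRD cisD rmorphM/=; ring.
Qed.

Lemma cexp_conj z : cexp (z^*) = (cexp z)^*.
Proof.
by case: z => a b; apply: reimP; rewrite /= ?reimE/= ?cosN ?sinN; ring.
Qed.
End complex_numbers.

Section complex_derivatives.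
Variable R : realType.
Local Notation Re := (@complex.Re R).
Local Notation Im := (@complex.Im R).

(** A relation rather than an operator, so that existence and value of the
    derivative travel together. *)
Definition cderive (u : R -> R[i]) (t : R) (d : R[i]) : Prop :=
  is_derive t (1:R) (fun s => Re (u s)) (Re d) /\
  is_derive t (1:R) (fun s => Im (u s)) (Im d).

Lemma cderive_eq (u : R -> R[i]) t d d' : cderive u t d -> d = d' -> cderive u t d'.
Proof. by move=> + <-. Qed.

Lemma cderive_cst c t : cderive (fun=> c) t 0.
Proof. by split => /=; exact: is_derive_cst. Qed.

Lemma cderiveD u v t du evec : cderive u t du -> cderive v t evec ->
  cderive (fun s => u s + v s) t (du + evec).
Proof.
move=> [u1 u2] [v1 v2]; split.
  under eq_fun do rewrite reD; rewrite reD; exact: is_deriveD.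
under eq_fun do rewrite imD; rewrite imD; exact: is_deriveD.
Qed.

Lemma is_derive_affine (a b t : R) : is_derive t (1:R) (fun s => a + s * b) b.
Proof.
have h := is_deriveD (is_derive_cst a t (1:R))
  (is_deriveM (is_derive_id t (1:R)) (is_derive_cst b t (1:R))).
apply: (@is_derive_eq _ _ _ _ _ _ _ _ h).
by rewrite scaler0 add0r add0r /GRing.scale/= mulr1.
Qed.

Lemma cderiveM u v t du evec : cderive u t du -> cderive v t evec ->
  cderive (fun s => u s * v s) t (du * v t + u t * evec).
Proof.
move=> [u1 u2] [v1 v2]; split.
  under eq_fun do rewrite reM.
  have h := is_deriveB (is_deriveM u1 v1) (is_deriveM u2 v2).
  apply: (@is_derive_eq _ _ _ _ _ _ _ _ h).
  rewrite !reimE /GRing.scale/=; ring.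
under eq_fun do rewrite imM.
have h := is_deriveD (is_deriveM u1 v2) (is_deriveM u2 v1).
apply: (@is_derive_eq _ _ _ _ _ _ _ _ h).
rewrite !reimE /GRing.scale/=; ring.
Qed.

Lemma cderive_real (u : R -> R) t d : is_derive t (1:R) u d ->
  cderive (fun s => (u s)%:C) t d%:C.
Proof. by move=> h; split => //=; exact: is_derive_cst. Qed.

Lemma cderive_cis (u : R -> R) t d : is_derive t (1:R) u d ->
  cderive (fun s => cis (u s)) t ('i%C * d%:C * cis (u t)).
Proof.
move=> h; split; rewrite /cis !reimE.
  apply: (@is_derive_eq _ _ _ (cos \o u)).
  rewrite !(mul0r, mul1r, mulr0, subr0, add0r, sub0r) /GRing.scale/=; ring.
apply: (@is_derive_eq _ _ _ (sin \o u)).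
rewrite !(mul0r, mul1r, mulr0, subr0, add0r, sub0r) /GRing.scale/=; ring.
Qed.

End complex_derivatives.

(** * Coordinate lines and partial derivatives *)

Section coordinates.
Variable R : realType.
Implicit Types (x : 'rV[R]_4) (j k : 'I_4) (f : 'rV[R]_4 -> R[i]).
Local Notation Re := (@complex.Re R).
Local Notation Im := (@complex.Im R).
Local Notation normc := (@Normc.normc R).

Definition evec j : 'rV[R]_4 := delta_mx 0 j.
(** Written as a translation along a coordinate line, so that partial
    derivatives become ordinary derivatives of [t |-> f (upd j t x)]. *)
Definition upd j (t : R) x : 'rV[R]_4 := x + (t - x 0 j) *: evec j.

Lemma line_coord x t j k : (x + t *: evec j) 0 k = x 0 k + t * (k == j)%:R.
Proof. by rewrite !mxE eqxx. Qed.

Lemma updE j t x k : (upd j t x) 0 k = if k == j then t else x 0 k.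
Proof.
by rewrite line_coord; case: eqP => [->|_]; rewrite ?mulr1 ?mulr0 ?addr0// subrKC.
Qed.

Lemma upd_same j t x : (upd j t x) 0 j = t.
Proof. by rewrite updE eqxx. Qed.

Lemma upd_other j k t x : k != j -> (upd j t x) 0 k = x 0 k.
Proof. by rewrite updE => /negbTE ->. Qed.

Lemma upd_id j x : upd j (x 0 j) x = x.
Proof. by rewrite /upd subrr scale0r addr0. Qed.

Lemma upd_upd j t s x : upd j t (upd j s x) = upd j t x.
Proof. by apply/rowP => k; rewrite !updE; case: eqP. Qed.

Lemma updC j k t s x : j != k -> upd j t (upd k s x) = upd k s (upd j t x).
Proof.
move=> jk; apply/rowP => l; rewrite !updE.
by case: eqP => [->|//]; rewrite (negbTE jk).
Qed.

Lemma upd_line j t s x : upd j t (x + s *: evec j) = upd j t x.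
Proof.
apply/rowP => l; rewrite !updE line_coord.
by case: eqP => // _; rewrite mulr0 addr0.
Qed.

Lemma upd_line_other j k t s x : k != j ->
  upd j t (x + s *: evec k) = upd j t x + s *: evec k.
Proof.
move=> kj; apply/rowP => l; rewrite updE [RHS]line_coord updE line_coord.
by case: (eqVneq l j) => // ->; rewrite eq_sym (negbTE kj) mulr0 addr0.
Qed.

Lemma upd_of_line j x t : upd j t x = upd j 0 x + t *: evec j.
Proof.
apply/rowP => l; rewrite updE [RHS]line_coord updE.
by case: eqP => _; rewrite ?mulr1 ?mulr0 ?add0r ?addr0.
Qed.

Definition pdiff j f x : Prop :=
  derivable (fun y => Re (f y)) x (evec j) /\
  derivable (fun y => Im (f y)) x (evec j).

Lemma growth_line (g : 'rV[R]_4 -> R) x v t :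
  (fun h : R => h^-1 *: ((g (h *: v + (x + t *: v)) : R^o) - g (x + t *: v))) =
  (fun h : R => h^-1 *: (((fun s => g (x + s *: v)) (h *: (1 : R) + t) : R^o)
     - (fun s => g (x + s *: v)) t)).
Proof.
apply/funext => h /=; congr (_ *: (g _ - _)).
by rewrite scalerDl scaler1 addrCA.
Qed.

(** A directional derivative is the derivative of the restriction to a line: the
    two difference quotients coincide. *)
Lemma derive_line (g : 'rV[R]_4 -> R) x v (t d : R) :
  is_derive (x + t *: v) v g d <-> is_derive t 1 (fun s => g (x + s *: v)) d.
Proof.
split => -[h1 h2]; split.
- by move: h1; rewrite /derivable growth_line.
- by rewrite -h2 /derive growth_line.
- by rewrite /derivable growth_line.
- by rewrite -h2 /derive growth_line.
Qed.

Lemma cderive_line f x j t : pdiff j f (x + t *: evec j) ->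
  cderive (fun s => f (x + s *: evec j)) t (pder j f (x + t *: evec j)).
Proof.
move=> [h1 h2]; split.
  by apply/(@derive_line (fun y => Re (f y))); exact: derivableP.
by apply/(@derive_line (fun y => Im (f y))); exact: derivableP.
Qed.

Lemma cderive_upd f x j t : pdiff j f (upd j t x) ->
  cderive (fun s => f (upd j s x)) t (pder j f (upd j t x)).
Proof.
under eq_fun do rewrite upd_of_line.
by rewrite upd_of_line => /cderive_line.
Qed.

Lemma pderE f x j d : cderive (fun s => f (x + s *: evec j)) 0 d ->
  pdiff j f x /\ pder j f x = d.
Proof.
move=> [/(@derive_line (fun y => Re (f y))) + /(@derive_line (fun y => Im (f y)))].
rewrite scale0r addr0 => h1 h2.
split; first by split; exact: ex_derive.
have e1 := @derive_val _ _ _ _ _ _ _ h1.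
have e2 := @derive_val _ _ _ _ _ _ _ h2.
by apply: reimP; rewrite /pder/= /evec.
Qed.

Lemma pders_rcons s j f : pders (rcons s j) f = pders s (pder j f).
Proof. by rewrite /pders foldr_rcons. Qed.

Definition cbounded (T : Type) (g : T -> R[i]) : Prop :=
  exists B : R, forall p : T, normc (g p) <= B.

(** Continuity of the derivatives follows from the bounds on those of the next
    order, see [bsmooth_continuous]. *)
Definition bsmooth f : Prop := forall s,
  cbounded (pders s f) /\ forall x j, pdiff j (pders s f) x.

(** Coinduction principle: smoothness is checked on a class of functions stable
    under partial derivatives, without computing iterated derivatives. *)
Lemma bsmooth_coind (P : ('rV[R]_4 -> R[i]) -> Prop) :
  (forall g, P g -> [/\ cbounded g, forall x j, pdiff j g x & forall j, P (pder j g)]) ->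
  forall g, P g -> bsmooth g.
Proof.
move=> hP g Pg s.
suff : P (pders s g) by move=> /hP[].
by elim: s => //= j s /hP[].
Qed.

Lemma bsmooth_bounded f : bsmooth f -> cbounded f.
Proof. by move=> /(_ [::])[]. Qed.

Lemma bsmooth_pdiff f x j : bsmooth f -> pdiff j f x.
Proof. by move=> /(_ [::])[]. Qed.

Lemma bsmooth_pder f j : bsmooth f -> bsmooth (pder j f).
Proof. by move=> fs s; rewrite -pders_rcons; exact: fs. Qed.

(** The bound is local because the derivative to which it is applied for the
    exponential series is unbounded on the line. *)
Lemma mvt_abs (u : R -> R) (du : R -> R) (B : R) (a : R) :
  (forall t, is_derive t (1:R) u (du t)) ->
  (forall t, `|t| <= `|a| -> `|du t| <= B) ->
  `|u a - u 0| <= B * `|a|.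
Proof.
move=> hu hB.
have cu : continuous u.
  by move=> t; apply/differentiable_continuous/derivable1_diffP; exact: ex_derive.
case: (ltgtP a 0) => [a0|a0|->]; last by rewrite subrr normr0 mulr0.
- have [|c ca e] := @MVT _ u du a 0 a0 (fun t _ => hu t).
    exact: continuous_subspaceT.
  rewrite distrC e normrM sub0r normrN ler_wpM2r// hB//.
  move: ca; rewrite in_itv/= => /andP[c1 c2].
  by rewrite !ltr0_norm// lerN2 ltW.
- have [|c ca e] := @MVT _ u du 0 a a0 (fun t _ => hu t).
    exact: continuous_subspaceT.
  rewrite e normrM subr0 ler_wpM2r// hB//.
  move: ca; rewrite in_itv/= => /andP[c1 c2].
  by rewrite !gtr0_norm// ltW.
Qed.

(** The increment is split along the four coordinate directions, each handled by
    the mean value theorem. *)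
Lemma part_bounded_lipschitz (g : 'rV[R]_4 -> R) (B : R) :
  (forall x j, derivable g x (evec j)) -> (forall x j, `|'D_(evec j) g x| <= B) ->
  forall x h, `|g (x + h) - g x| <= \sum_(j < 4) B * `|h 0 j|.
Proof.
move=> hd hB x h.
rewrite [in X in g (x + X)](row_sum_delta h) -[index_enum _]/(index_enum 'I_4).
elim: (index_enum _) => [|j l IH].
  by rewrite !big_nil addr0 subrr normr0.
rewrite !big_cons [h 0 j *: _ + _]addrC addrA.
set y := x + _ in IH *.
rewrite -(subrK (g y) (g (y + _))) -addrA.
apply: le_trans (ler_normD _ _) _; apply: lerD => //.
have := @mvt_abs (fun s => g (y + s *: evec j))
  (fun s => 'D_(evec j) g (y + s *: evec j)) B (h 0 j).
rewrite scale0r addr0; apply => t; last by move=> _; exact: hB.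
by apply/(@derive_line g); exact: derivableP.
Qed.

Lemma part_bounded_continuous (g : 'rV[R]_4 -> R) (B : R) :
  (forall x j, derivable g x (evec j)) -> (forall x j, `|'D_(evec j) g x| <= B) ->
  continuous g.
Proof.
move=> hd hB x; apply/(@cvgrPdist_le _ _ _ _ (nbhs_filter x)) => e e0.
have B0 : 0 <= B by exact: le_trans (normr_ge0 _) (hB 0 ord0).
have d0 : 0 < e / (4 * (B + 1)) by rewrite divr_gt0// mulr_gt0// ltr_wpDl.
near=> y.
rewrite distrC -[in g y](subrKC x y).
apply: le_trans (part_bounded_lipschitz hd hB _ _) _.
have h1 : forall j : 'I_4, `|(y - x) 0 j| <= e / (4 * (B + 1)).
  near: y; apply/nbhs_ballP; exists (e / (4 * (B + 1))) => //= z [_ xz] j.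
  by have /ltW := xz 0 j; rewrite !mxE distrC.
have hj (j : 'I_4) : B * `|(y - x) 0 j| <= e / 4.
  apply: (@le_trans _ _ ((B + 1) * (e / (4 * (B + 1))))).
    by apply: ler_pM => //; rewrite lerDl.
  rewrite invfM mulrCA [_ * (_ / _)]mulrCA divff ?mulr1//.
  by rewrite gt_eqF// ltr_wpDl.
apply: (@le_trans _ _ (\sum_(j < 4) e / 4)); first by apply: ler_sum.
by rewrite sumr_const card_ord -[leLHS]mulr_natr divfK.
Unshelve. all: by end_near. Qed.

End coordinates.

(** * Smooth functions with bounded derivatives *)

Section bounded_smooth.
Variable R : realType.
Implicit Types (x : 'rV[R]_4) (j k : 'I_4) (f g : 'rV[R]_4 -> R[i]).
Local Notation Re := (@complex.Re R).
Local Notation Im := (@complex.Im R).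
Local Notation normc := (@Normc.normc R).
Local Notation evec := (@evec R).

Lemma pdiff_cderive f x j : pdiff j f x ->
  cderive (fun s => f (x + s *: evec j)) 0 (pder j f x).
Proof.
move=> h; have := @cderive_line _ f x j 0.
by rewrite scale0r addr0; apply.
Qed.

Lemma pderD f g x j : pdiff j f x -> pdiff j g x ->
  pdiff j (fun y => f y + g y) x /\
  pder j (fun y => f y + g y) x = pder j f x + pder j g x.
Proof.
by move=> /pdiff_cderive hf /pdiff_cderive hg; apply: pderE; exact: cderiveD.
Qed.

Lemma pderM f g x j : pdiff j f x -> pdiff j g x ->
  pdiff j (fun y => f y * g y) x /\
  pder j (fun y => f y * g y) x = pder j f x * g x + f x * pder j g x.
Proof.
move=> /pdiff_cderive hf /pdiff_cderive hg; apply: pderE.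
by have := cderiveM hf hg; rewrite scale0r addr0.
Qed.

Lemma pder_cst (c : R[i]) x j : pdiff j (fun=> c) x /\ pder j (fun=> c) x = 0.
Proof. by apply: pderE; exact: cderive_cst. Qed.

Lemma pder_coord x j k :
  pdiff j (fun y => (y 0 k)%:C) x /\
  pder j (fun y => (y 0 k)%:C) x = (k == j)%:R.
Proof.
apply: pderE; under eq_fun do rewrite line_coord.
rewrite -(rmorph_nat (real_complex R)); apply: cderive_real.
exact: is_derive_affine.
Qed.

Lemma pderZ (c : R[i]) f x j : pdiff j f x ->
  pdiff j (fun y => c * f y) x /\ pder j (fun y => c * f y) x = c * pder j f x.
Proof.
move=> hf; have [h1 h2] := pder_cst c x j.
by have [] := pderM h1 hf; rewrite h2 mul0r add0r.
Qed.

Lemma bsmoothD f g : bsmooth f -> bsmooth g -> bsmooth (fun x => f x + g x).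
Proof.
move=> fs gs.
apply: (@bsmooth_coind _ (fun h => exists f g,
   [/\ bsmooth f, bsmooth g & h = fun x => f x + g x])); last by exists f, g.
move=> _ [{fs gs}f [{}g [fs gs ->]]]; split.
- have [B fB] := bsmooth_bounded fs; have [C gC] := bsmooth_bounded gs.
  by exists (B + C) => x; apply: le_trans (normcD _ _) _; exact: lerD.
- by move=> x j; apply: (pderD _ _).1; exact: bsmooth_pdiff.
- move=> j; exists (pder j f), (pder j g); split; try exact: bsmooth_pder.
  by apply/funext => x; apply: (pderD _ _).2; exact: bsmooth_pdiff.
Qed.

Lemma bsmoothZ c f : bsmooth f -> bsmooth (fun x => c * f x).
Proof.
move=> fs.
apply: (@bsmooth_coind _ (fun h => exists2 f, bsmooth f & h = fun x => c * f x));
  last by exists f.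
move=> _ [{fs}f fs ->]; split.
- have [B fB] := bsmooth_bounded fs.
  exists (normc c * B) => x; rewrite Normc.normcM.
  by apply: ler_pM => //; exact: normc_ge0.
- by move=> x j; apply: (pderZ _ _).1; exact: bsmooth_pdiff.
- move=> j; exists (pder j f); first exact: bsmooth_pder.
  by apply/funext => x; apply: (pderZ _ _).2; exact: bsmooth_pdiff.
Qed.

Lemma bsmooth_continuous f : bsmooth f ->
  continuous (fun x => Re (f x)) /\ continuous (fun x => Im (f x)).
Proof.
move=> fs.
have /choice[B hB] : forall j, exists B : R, forall x, normc (pder j f x) <= B.
  by move=> j; exact: bsmooth_bounded (bsmooth_pder j fs).
have hB' x j : normc (pder j f x) <= \sum_(k < 4) B k.
  rewrite (bigD1 j)//=; apply: le_trans (hB j x) _; rewrite lerDl.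
  by apply: sumr_ge0 => k _; exact: le_trans (normc_ge0 _) (hB k x).
split; apply: (@part_bounded_continuous _ _ (\sum_(k < 4) B k)) => x j.
- by have [] := bsmooth_pdiff x j fs.
- exact: le_trans (re_le_normc (pder j f x)) (hB' x j).
- by have [] := bsmooth_pdiff x j fs.
- exact: le_trans (im_le_normc (pder j f x)) (hB' x j).
Qed.

Lemma pder_near0 f x j : (\forall y \near x, f y = 0) -> pder j f x = 0.
Proof.
move=> f0; apply: reimP; rewrite /pder/=.
  have := @near_eq_derive _ _ _ (fun y => Re (f y)) (cst 0) x (delta_mx 0 j).
  by rewrite derive_cst; apply; apply: filterS f0 => y ->.
have := @near_eq_derive _ _ _ (fun y => Im (f y)) (cst 0) x (delta_mx 0 j).
by rewrite derive_cst; apply; apply: filterS f0 => y ->.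
Qed.

Definition vanish j f : Prop := exists M : R, forall x, M < `|x 0 j| -> f x = 0.

Lemma vanish_pder j k f : vanish j f -> vanish j (pder k f).
Proof.
move=> [M fM]; exists M => x Mx; apply: pder_near0.
have h : `|y 0 j| @[y --> x] --> `|x 0 j|.
  by apply: cvg_norm; exact: coord_continuous.
near=> y; apply: fM.
by near: y; apply: (cvgr_gt _ h).
Unshelve. all: by end_near. Qed.

Lemma vanishD j f g : vanish j f -> vanish j g -> vanish j (fun x => f x + g x).
Proof.
move=> [M hf] [N hg]; exists (Num.max M N) => x; rewrite gt_max => /andP[h1 h2].
by rewrite hf// hg// addr0.
Qed.

Lemma vanishMl j f g : vanish j f -> vanish j (fun x => g x * f x).
Proof. by move=> [M hf]; exists M => x /hf ->; rewrite mulr0. Qed.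

(** The coordinate is unbounded, but the support of f is bounded in its
    direction.  The class of functions [x_j f + g] is stable under derivatives. *)
Lemma bsmooth_coordM j f : bsmooth f -> vanish j f ->
  bsmooth (fun x => (x 0 j)%:C * f x).
Proof.
move=> fs fv.
apply: (@bsmooth_coind _ (fun h => exists f g,
   [/\ bsmooth f, vanish j f, bsmooth g & h = fun x => (x 0 j)%:C * f x + g x]));
  last first.
  exists f, (fun x => 0 * f x); split => //; first exact: bsmoothZ.
  by apply/funext => x; rewrite mul0r addr0.
move=> _ {fs fv}[{}f [g [fs fv gs ->]]].
have hM x k : pdiff k (fun y => (y 0 j)%:C * f y) x /\
   pder k (fun y => (y 0 j)%:C * f y) x = (j == k)%:R * f x + (x 0 j)%:C * pder k f x.
  have [h1 h2] := pder_coord x k j.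
  by have [] := pderM h1 (bsmooth_pdiff x k fs); rewrite h2.
split.
- have [B fB] := bsmooth_bounded fs; have [C gC] := bsmooth_bounded gs.
  have [M fM] := fv.
  exists (`|M| * B + C) => x; apply: le_trans (normcD _ _) _; apply: lerD => //.
  rewrite Normc.normcM normc_real.
  have [Mx|xM] := ltP M `|x 0 j|.
    rewrite fM// Normc.normc0 mulr0 mulr_ge0//; exact: le_trans (normc_ge0 _) (fB x).
  apply: ler_pM => //; first exact: normc_ge0.
  exact: le_trans xM (ler_norm _).
- by move=> x k; apply: (pderD _ _).1; [exact: (hM _ _).1|exact: bsmooth_pdiff].
- move=> k; exists (pder k f), (fun x => (j == k)%:R * f x + pder k g x); split.
  + exact: bsmooth_pder.
  + exact: vanish_pder.
  + by apply: bsmoothD; [exact: bsmoothZ|exact: bsmooth_pder].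
  + apply/funext => x; rewrite (pderD (hM x k).1 (bsmooth_pdiff x k gs)).2 (hM x k).2.
    by rewrite addrCA addrA.
Qed.

End bounded_smooth.

(** * Complex-valued integrals and Fubini's theorem *)

Section caratheodory.
Variable R : realType.
Local Notation leb := (@lebesgue_measure R).

Let step (n : nat) (s : R) : R := (Num.floor (n.+1%:R * s))%:~R / n.+1%:R.

Let step_le n s : `|step n s - s| <= n.+1%:R^-1.
Proof.
have /andP[h1 h2] := floor_itv (n.+1%:R * s).
have n0 : (0 : R) < n.+1%:R by [].
have h3 : step n s <= s by rewrite /step ler_pdivrMr ?ltr0Sn// [s * _]mulrC.
rewrite distrC ger0_norm ?subr_ge0// lerBlDl /step -[X in _ + X]mul1r -mulrDl.
by rewrite ler_pdivlMr// mulrC ltW// (lt_le_trans h2)// intrD.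
Qed.

Let step_cvg s : step n s @[n --> \oo] --> s.
Proof.
apply/cvgrPdist_le => e e0.
near=> n; rewrite distrC; apply: le_trans (step_le n s) _.
near: n; apply: filterS (near_infty_natSinv_lt (PosNum e0)) => n; exact: ltW.
Unshelve. all: by end_near. Qed.

(** Rounding the first variable down to a multiple of 1 / (n + 1) gives measurable
    functions, since they are measurable on countably many strips; they converge
    pointwise to G by continuity in the first variable. *)
Lemma measurable_separately_continuous (G : R * R -> R) :
  (forall s, continuous (fun t => G (s, t))) ->
  (forall t, continuous (fun s => G (s, t))) ->
  measurable_fun (setT : set (measurableTypeR R * measurableTypeR R)) G.
Proof.
move=> c2 c1.
apply: (measurable_realfun.measurable_fun_cvg (h := fun n p => G (step n p.1, p.2))).
  move=> n _ Y mY; rewrite setTI.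
  have -> : (fun p : R * R => G (step n p.1, p.2)) @^-1` Y =
    \bigcup_(k : int) (((fun s => step n s) @^-1` [set k%:~R / n.+1%:R]) `*`
       ((fun t => G (k%:~R / n.+1%:R, t)) @^-1` Y)).
    apply/seteqP; split=> [[s t] /= h|[s t] [k _] [/= -> //]].
    by exists (Num.floor (n.+1%:R * s)).
  apply: countable_bigcupT_measurable => // k; apply: measurableX.
    have -> : (fun s => step n s) @^-1` [set k%:~R / n.+1%:R] =
       [set` `[k%:~R / n.+1%:R, (k + 1)%:~R / n.+1%:R[ ] :> set R.
      apply/seteqP; split=> s /=; rewrite /step in_itv/= ler_pdivrMr// ltr_pdivlMr//.
        have n1 : (n.+1%:R : R)^-1 != 0 by rewrite invr_eq0 pnatr_eq0.
        by move=> /(mulIf n1)/intr_inj <-; rewrite mulrC; exact: floor_itv.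
      by rewrite mulrC => /floor_def ->.
    exact: measurable_itv.
  rewrite -[X in measurable X]setTI.
  exact: (continuous_measurable_fun (c2 _)).
move=> [s t] _ /=.
exact: (cvg_comp (fun n => step n s) (fun s => G (s, t)) (@step_cvg s) (c1 t s)).
Qed.

End caratheodory.

Section complex_integral.
Context d (T : measurableType d) (R : realType) (mu : {measure set T -> \bar R}).
Local Notation Re := (@complex.Re R).
Local Notation Im := (@complex.Im R).
Local Notation normc := (@Normc.normc R).
Implicit Types g h : T -> R[i].

Definition cintble g : Prop :=
  mu.-integrable setT (fun p => (Re (g p))%:E) /\
  mu.-integrable setT (fun p => (Im (g p))%:E).

Definition cint g : R[i] := (\int[mu]_p Re (g p)) +i* (\int[mu]_p Im (g p)).

Lemma re_cint g : Re (cint g) = \int[mu]_p Re (g p). Proof. by []. Qed.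
Lemma im_cint g : Im (cint g) = \int[mu]_p Im (g p). Proof. by []. Qed.

Definition cmeasurable g : Prop :=
  measurable_fun setT (fun p => Re (g p)) /\
  measurable_fun setT (fun p => Im (g p)).

Lemma cintble_dom g (b : T -> R) : cmeasurable g ->
  mu.-integrable setT (EFin \o b) -> (forall p, normc (g p) <= b p) ->
  cintble g.
Proof.
move=> [m1 m2] ib gb; split; apply: le_integrable ib => //.
- exact/measurable_EFinP.
- move=> p _ /=; rewrite lee_fin (le_trans (re_le_normc _))// (le_trans (gb _))//.
  exact: ler_norm.
- exact/measurable_EFinP.
- move=> p _ /=; rewrite lee_fin (le_trans (im_le_normc _))// (le_trans (gb _))//.
  exact: ler_norm.
Qed.

Lemma cintbleD g h : cintble g -> cintble h -> cintble (fun p => g p + h p).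
Proof.
move=> [g1 g2] [h1 h2]; split.
  under eq_fun do rewrite reD EFinD; exact: integrableD.
under eq_fun do rewrite imD EFinD; exact: integrableD.
Qed.

Lemma cintD g h : cintble g -> cintble h ->
  cint (fun p => g p + h p) = cint g + cint h.
Proof.
move=> [g1 g2] [h1 h2]; apply: reimP; rewrite !(reD, imD, reM, imM) !(re_cint, im_cint).
  under eq_Rintegral do rewrite reD; exact: RintegralD.
under eq_Rintegral do rewrite imD; exact: RintegralD.
Qed.

Lemma cintbleZ c g : cintble g -> cintble (fun p => c * g p).
Proof.
move=> [g1 g2]; split.
  under eq_fun do rewrite reM EFinB !EFinM.
  by apply: integrableB => //; exact: integrableZl.
under eq_fun do rewrite imM EFinD !EFinM.
by apply: integrableD => //; exact: integrableZl.
Qed.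

Let integrable_scale (k : R) (f : T -> R) :
  mu.-integrable setT (fun p => (f p)%:E) ->
  mu.-integrable setT (EFin \o (fun p => k * f p)).
Proof. by move=> h; apply: eq_integrable (integrableZl _ k h). Qed.

Lemma cintZ c g : cintble g -> cint (fun p => c * g p) = c * cint g.
Proof.
move=> [g1 g2]; apply: reimP; rewrite !(reD, imD, reM, imM) !(re_cint, im_cint).
  under eq_Rintegral do rewrite reM.
  rewrite RintegralB ?RintegralZl//; exact: integrable_scale.
under eq_Rintegral do rewrite imM.
rewrite RintegralD ?RintegralZl//; exact: integrable_scale.
Qed.

Lemma eq_cint g h : g =1 h -> cint g = cint h.
Proof. by move=> /funext ->. Qed.

Lemma cint0 : cint (fun=> 0) = 0.
Proof. by rewrite /cint; apply: reimP => /=; rewrite /Rintegral integral0. Qed.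

Lemma normc_cint g (b : T -> R) : cintble g ->
  mu.-integrable setT (EFin \o b) -> (forall p, normc (g p) <= b p) ->
  normc (cint g) <= 2 * \int[mu]_p b p.
Proof.
move=> [g1 g2] ib gb; apply: le_trans (normc_le _) _.
rewrite mulr_natl mulr2n; apply: lerD => /=.
  apply: le_trans (le_normr_Rintegral _ _) _ => //.
  apply: le_Rintegral => //; first exact: integrable_norm.
  by move=> p _; rewrite (le_trans (re_le_normc _)).
apply: le_trans (le_normr_Rintegral _ _) _ => //.
apply: le_Rintegral => //; first exact: integrable_norm.
by move=> p _; rewrite (le_trans (im_le_normc _)).
Qed.

End complex_integral.

Section complex_fubini.
Context d1 d2 (T1 : measurableType d1) (T2 : measurableType d2) (R : realType).
Variables (m1 : {sigma_finite_measure set T1 -> \bar R})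
  (m2 : {sigma_finite_measure set T2 -> \bar R}).
Local Notation Re := (@complex.Re R).
Local Notation Im := (@complex.Im R).
Local Notation normc := (@Normc.normc R).
Local Notation m12 := (m1 \x m2)%E.

Let fub1 (f : T1 * T2 -> R) : m12.-integrable setT (fun p => (f p)%:E) ->
  (forall x, m2.-integrable setT (fun y => (f (x, y))%:E)) ->
  \int[m12]_p f p = \int[m1]_x \int[m2]_y f (x, y).
Proof.
move=> fi fx; rewrite /Rintegral -integral12_prod_meas1//; congr fine.
by apply: eq_integral => x _; rewrite fineK//; exact: integrable_fin_num.
Qed.

Let fub2 (f : T1 * T2 -> R) : m12.-integrable setT (fun p => (f p)%:E) ->
  (forall y, m1.-integrable setT (fun x => (f (x, y))%:E)) ->
  \int[m12]_p f p = \int[m2]_y \int[m1]_x f (x, y).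
Proof.
move=> fi fx; rewrite /Rintegral -integral21_prod_meas1//; congr fine.
by apply: eq_integral => x _; rewrite fineK//; exact: integrable_fin_num.
Qed.

(** The sections are assumed integrable everywhere, not just almost everywhere,
    because the inner real-valued integral forgets infinite values. *)
Lemma cint_prod12 (g : T1 * T2 -> R[i]) : cintble m12 g ->
  (forall x, cintble m2 (fun y => g (x, y))) ->
  cint m12 g = cint m1 (fun x => cint m2 (fun y => g (x, y))).
Proof.
move=> [g1 g2] gx; apply: reimP => /=.
  by rewrite fub1// => x; have [] := gx x.
by rewrite fub1// => x; have [] := gx x.
Qed.

Lemma cint_prod21 (g : T1 * T2 -> R[i]) : cintble m12 g ->
  (forall y, cintble m1 (fun x => g (x, y))) ->
  cint m12 g = cint m2 (fun y => cint m1 (fun x => g (x, y))).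
Proof.
move=> [g1 g2] gx; apply: reimP => /=.
  by rewrite fub2// => x; have [] := gx x.
by rewrite fub2// => x; have [] := gx x.
Qed.

Lemma integrable_prod_dom (a : T1 -> R) (b : T2 -> R) :
  (forall x, 0 <= a x) -> (forall y, 0 <= b y) ->
  m1.-integrable setT (EFin \o a) -> m2.-integrable setT (EFin \o b) ->
  m12.-integrable setT (EFin \o (fun p => a p.1 * b p.2)).
Proof.
move=> a0 b0 ia ib.
apply/integrable12ltyP.
  apply/measurable_EFinP; apply: measurable_funM.
    by apply: measurableT_comp => //; apply/measurable_EFinP; exact: measurable_int ia.
  by apply: measurableT_comp => //; apply/measurable_EFinP; exact: measurable_int ib.
have -> : (\int[m1]_x \int[m2]_y `|(a x * b y)%R%:E|)%E =
  (\int[m1]_x ((fine (\int[m2]_y (b y)%:E))%:E * (a x)%:E))%E.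
  apply: eq_integral => x _.
  rewrite fineK; last exact: integrable_fin_num.
  rewrite muleC -integralZl//; apply: eq_integral => y _ /=.
  by rewrite ger0_norm// mulr_ge0.
rewrite integralZl// fineK; last exact: integrable_fin_num.
rewrite lte_mul_pinfty//.
- by apply: integral_ge0 => y _; rewrite lee_fin.
- exact: integrable_fin_num.
- by rewrite -ge0_fin_numE; [exact: integrable_fin_num|apply: integral_ge0 => x _; rewrite lee_fin].
Qed.

End complex_fubini.

(** * Integrals over the real line *)

Section line.
Variable R : realType.
Local Notation Re := (@complex.Re R).
Local Notation Im := (@complex.Im R).
Local Notation normc := (@Normc.normc R).
Local Notation leb := (@lebesgue_measure R).
Local Notation lmeasurable := (@cmeasurable _ (measurableTypeR R) R).

(** Integrands over the line are dominated by multiples of this function. *)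
Definition wt (s : R) : R := (oneDsqr s)^-1.

Lemma wt_gt0 s : 0 < wt s. Proof. by rewrite invr_gt0. Qed.
Lemma wt_ge0 s : 0 <= wt s. Proof. exact/ltW/wt_gt0. Qed.

Lemma integrable_wt : leb.-integrable setT (EFin \o wt).
Proof.
have cw : continuous wt by exact: continuous_oneDsqrV.
apply/integrableP; split.
  by apply/measurable_EFinP; exact: continuous_measurable_fun.
under eq_integral do rewrite gee0_abs ?lee_fin ?wt_ge0//.
rewrite (@ge0_symfun_integralT _ wt)//.
- rewrite (_ : [set x : R | _] = `[0, +oo[%classic); last first.
    by apply/seteqP; split => x/=; rewrite in_itv/= andbT.
  by rewrite integral0y_oneDsqr -EFinM ltry.
- exact: wt_ge0.
- by move=> s; rewrite /wt /= /oneDsqr sqrrN.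
Qed.

Definition ccontinuous (g : R -> R[i]) : Prop :=
  continuous (fun s => Re (g s)) /\ continuous (fun s => Im (g s)).

Definition wbounded (g : R -> R[i]) : Prop :=
  exists C : R, forall s, normc (g s) <= C * wt s.

Lemma ccontinuous_cmeasurable (g : R -> R[i]) : ccontinuous g -> lmeasurable g.
Proof. by move=> [h1 h2]; split; exact: continuous_measurable_fun. Qed.

Lemma integrable_wtZ (C : R) : leb.-integrable setT (EFin \o (fun s => C * wt s)).
Proof.
by apply: eq_integrable (integrableZl _ C integrable_wt).
Qed.

Lemma cintble_wbounded (g : R -> R[i]) : lmeasurable g -> wbounded g -> cintble leb g.
Proof.
move=> mg [C gC]; exact: (cintble_dom mg (integrable_wtZ C) gC).
Qed.

(** On the support |s| <= M one has 1 <= (1 + M^2) wt s. *)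
Lemma wbounded_compact (g : R -> R[i]) (B M : R) : (forall s, normc (g s) <= B) ->
  (forall s, M < `|s| -> g s = 0) -> wbounded g.
Proof.
move=> gB g0; exists (B * (1 + M ^+ 2)) => s.
have B0 : 0 <= B by exact: le_trans (normc_ge0 _) (gB 0).
have [Ms|sM] := ltP M `|s|.
  by rewrite g0// Normc.normc0 mulr_ge0// ?wt_ge0// mulr_ge0// addr_ge0// sqr_ge0.
apply: le_trans (gB s) _; rewrite -mulrA ler_peMr// /wt ler_pdivlMr// mul1r.
by rewrite /oneDsqr lerD2l -real_normK ?num_real// ler_pXn2r// ?nnegrE// (le_trans _ sM).
Qed.

Lemma ccontinuousM (g h : R -> R[i]) : ccontinuous g -> ccontinuous h ->
  ccontinuous (fun s => g s * h s).
Proof.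
move=> [g1 g2] [h1 h2]; split => s.
  under eq_fun do rewrite reM.
  by apply: cvgB; apply: cvgM; [exact: g1|exact: h1|exact: g2|exact: h2].
under eq_fun do rewrite imM.
by apply: cvgD; apply: cvgM; [exact: g1|exact: h2|exact: g2|exact: h1].
Qed.

Lemma ccontinuous_real (u : R -> R) : continuous u -> ccontinuous (fun s => (u s)%:C).
Proof. by move=> cu; split => //= s; exact: cvg_cst. Qed.

Lemma ccontinuous_cst (c : R[i]) : ccontinuous (fun=> c).
Proof. by split => s; exact: cvg_cst. Qed.

Lemma ccontinuous_cis (a : R) : ccontinuous (fun s => cis (s * a)).
Proof.
have h : continuous (fun s : R => s * a).
  by move=> s; apply: cvgM; [exact: cvg_id|exact: cvg_cst].
split => s.
  exact: (cvg_comp (fun s => s * a) cos (h s) (@continuous_cos _ _)).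
exact: (cvg_comp (fun s => s * a) sin (h s) (@continuous_sin _ _)).
Qed.

Lemma cderive_ccontinuous (u u' : R -> R[i]) :
  (forall t, cderive u t (u' t)) -> ccontinuous u.
Proof.
move=> hu; split => t; apply/differentiable_continuous/derivable1_diffP.
  by have [h _] := hu t; exact: ex_derive.
by have [_ h] := hu t; exact: ex_derive.
Qed.

Definition ccvg (u : nat -> R[i]) (l : R[i]) : Prop :=
  (Re (u n) @[n --> \oo] --> Re l) /\ (Im (u n) @[n --> \oo] --> Im l).

Lemma ccvg_unique u l l' : ccvg u l -> ccvg u l' -> l = l'.
Proof.
move=> [h1 h2] [h3 h4]; apply: reimP.
  exact: (cvg_unique _ h1 h3).
exact: (cvg_unique _ h2 h4).
Qed.

Lemma ccvgD u v l m : ccvg u l -> ccvg v m -> ccvg (fun n => u n + v n) (l + m).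
Proof.
move=> [h1 h2] [h3 h4]; split.
  by under eq_fun do rewrite reD; rewrite reD; exact: cvgD.
by under eq_fun do rewrite imD; rewrite imD; exact: cvgD.
Qed.

Lemma ccvgM u v l m : ccvg u l -> ccvg v m -> ccvg (fun n => u n * v n) (l * m).
Proof.
move=> [h1 h2] [h3 h4]; split.
  by under eq_fun do rewrite reM; rewrite reM; apply: cvgB; exact: cvgM.
by under eq_fun do rewrite imM; rewrite imM; apply: cvgD; exact: cvgM.
Qed.

Lemma ccvg_cst c : ccvg (fun=> c) c.
Proof. by split; exact: cvg_cst. Qed.

Lemma ccvg_real (u : nat -> R) (l : R) : u n @[n --> \oo] --> l -> ccvg (fun n => (u n)%:C) l%:C.
Proof. by move=> h; split => //=; exact: cvg_cst. Qed.

Lemma ccvg_normc0 (u : nat -> R[i]) (b : nat -> R) : (forall n, normc (u n) <= b n) ->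
  b n @[n --> \oo] --> 0 -> ccvg u 0.
Proof.
move=> ub b0.
have sq (v : nat -> R) : (forall n, `|v n| <= b n) -> v n @[n --> \oo] --> 0.
  move=> vb; apply/norm_cvg0P.
  apply: (@squeeze_cvgr _ _ _ _ (cst 0) b); [|exact: cvg_cst|exact: b0].
  by apply: nearW => n; rewrite normr_ge0 vb.
split; apply: sq => n; first exact: le_trans (re_le_normc _) (ub n).
exact: le_trans (im_le_normc _) (ub n).
Qed.

Lemma cint_dominated (g : nat -> R -> R[i]) (g0 : R -> R[i]) (b : R -> R) :
  (forall n, lmeasurable (g n)) -> (forall s, ccvg (g ^~ s) (g0 s)) ->
  leb.-integrable setT (EFin \o b) -> (forall n s, normc (g n s) <= b s) ->
  ccvg (fun n => cint leb (g n)) (cint leb g0).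
Proof.
move=> mg cg ib gb.
have dom (f : nat -> R -> R) (f0 : R -> R) :
   (forall n, measurable_fun (setT : set (measurableTypeR R)) (f n)) ->
   (forall s, f n s @[n --> \oo] --> f0 s) -> (forall n s, `|f n s| <= b s) ->
   (\int[leb]_s f n s) @[n --> \oo] --> \int[leb]_s f0 s.
  move=> mf cf fb.
  have mf0 : measurable_fun (setT : set (measurableTypeR R)) f0.
    exact: (measurable_fun_cvg mf (fun s _ => cf s)).
  have cE : {ae leb, forall s, setT s -> (fun n => (f n s)%:E) @ \oo --> (f0 s)%:E}.
    by apply: aeW => s _; apply: cvg_EFin; [exact: nearW|exact: cf].
  have bE : {ae leb, forall s (n : nat), setT s -> (`|(f n s)%:E| <= (b s)%:E)%E}.
    by apply: aeW => s n _; rewrite lee_fin.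
  have mE n : measurable_fun (setT : set (measurableTypeR R)) (EFin \o f n).
    exact/measurable_EFinP.
  have [i0 _ h] := @dominated_convergence _ _ _ leb setT measurableT
    (fun n s => (f n s)%:E) (EFin \o f0) (EFin \o b) mE
    ((measurable_EFinP _ _).2 mf0) cE ib bE.
  have fin := integrable_fin_num measurableT i0.
  by apply: fine_cvg; rewrite fineK.
split; apply: dom.
- by move=> n; have [] := mg n.
- by move=> s; have [] := cg s.
- by move=> n s; exact: le_trans (re_le_normc _) (gb n s).
- by move=> n; have [] := mg n.
- by move=> s; have [] := cg s.
- by move=> n s; exact: le_trans (im_le_normc _) (gb n s).
Qed.

(** Used to differentiate transforms in the dual variables and in w. *)
Lemma cderive_cint (phi phi' : R -> R -> R[i]) (C : R) (t0 : R) :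
  (forall t, cintble leb (phi t)) ->
  (forall t s, cderive (phi ^~ s) t (phi' t s)) ->
  (forall t s, normc (phi' t s) <= C * wt s) ->
  cderive (fun t => cint leb (phi t)) t0 (cint leb (phi' t0)).
Proof.
move=> hi hd hC.
have C0 : 0 <= C.
  by have := le_trans (normc_ge0 _) (hC 0 0); rewrite pmulr_lge0// wt_gt0.
have under (f f' : R -> R -> R) :
   (forall t, leb.-integrable setT (EFin \o f t)) ->
   (forall t s, is_derive t (1:R) (f ^~ s) (f' t s)) ->
   (forall t s, `|f' t s| <= C * wt s) ->
   is_derive t0 (1:R) (fun t => \int[leb]_s f t s) (\int[leb]_s f' t0 s).
  move=> fi fd fC.
  have It : `]t0 - 1, t0 + 1[%classic t0.
    by rewrite /= in_itv/= ltrDl ltr01 ltrBlDr ltrDl ltr01.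
  have e t s : partial1of2 f t s = f' t s by rewrite partial1of2E; exact: derive_val.
  have G0 y : 0 <= C * wt y by rewrite mulr_ge0// wt_ge0.
  have d1 t s : derivable (f ^~ s) t 1 by exact: ex_derive.
  have dd := @derivable_under_integral _ _ _ leb f setT measurableT t0 _ _ It
     (fun t _ => fi t) (fun t s _ _ => d1 t s) _ G0 (integrable_wtZ C)
     (fun t s _ _ => eq_ind_r (fun z => `|z| <= C * wt s) (fC t s) (e t s)).
  have evec := @differentiation_under_integral _ _ _ leb f setT measurableT t0 _ _ It
     (fun t _ => fi t) (fun t s _ _ => d1 t s) _ G0 (integrable_wtZ C)
     (fun t s _ _ => eq_ind_r (fun z => `|z| <= C * wt s) (fC t s) (e t s)).
  apply: DeriveDef => //; rewrite -derive1E evec.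
  by apply: eq_Rintegral => s _; rewrite e.
split.
  apply: (under (fun t s => Re (phi t s)) (fun t s => Re (phi' t s))).
  - by move=> t; have [] := hi t.
  - by move=> t s; have [] := hd t s.
  - by move=> t s; exact: le_trans (re_le_normc _) (hC t s).
apply: (under (fun t s => Im (phi t s)) (fun t s => Im (phi' t s))).
- by move=> t; have [] := hi t.
- by move=> t s; have [] := hd t s.
- by move=> t s; exact: le_trans (im_le_normc _) (hC t s).
Qed.

Lemma ftc_segment (F f : R -> R) (a b : R) : a < b ->
  (forall t, is_derive t (1:R) F (f t)) -> continuous f ->
  (\int[leb]_(t in `[a, b]) f t) = F b - F a.
Proof.
move=> ab dF cf.
have cF : continuous F.
  by move=> t; apply/differentiable_continuous/derivable1_diffP; exact: ex_derive.
rewrite /Rintegral (@continuous_FTC2 _ f F)//.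
- exact: continuous_subspaceT.
- split; first by move=> t _; exact: ex_derive.
    exact/cvg_at_right_filter/cF.
  exact/cvg_at_left_filter/cF.
- by move=> t _; rewrite derive1E; exact: derive_val.
Qed.

(** Boundary terms vanish in the fundamental theorem of calculus; this is the
    form in which integration by parts is used. *)
Lemma cint_derive_compact (u u' : R -> R[i]) (M : R) :
  (forall t, cderive u t (u' t)) -> ccontinuous u' ->
  (forall t, M < `|t| -> u t = 0 /\ u' t = 0) -> cint leb u' = 0.
Proof.
move=> du [c1 c2] uM.
have main (F f : R -> R) : (forall t, is_derive t (1:R) F (f t)) -> continuous f ->
   (forall t, M < `|t| -> F t = 0 /\ f t = 0) -> \int[leb]_s f s = 0.
  move=> dF cf FM.
  pose N := `|M| + 1.
  have N0 : 0 < N by rewrite ltr_wpDl.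
  have MN : M < N by rewrite /N (le_lt_trans (ler_norm M))// ltrDl.
  have [F1 _] : F N = 0 /\ f N = 0 by apply: FM; rewrite gtr0_norm.
  have [F2 _] : F (- N) = 0 /\ f (- N) = 0 by apply: FM; rewrite normrN gtr0_norm.
  have : \int[leb]_(t in `[- N, N]) f t = 0.
    rewrite (ftc_segment _ dF cf) ?F1 ?F2 ?subrr//.
    by rewrite (lt_trans _ N0)// oppr_lt0.
  rewrite Rintegral_mkcond => <-; apply: eq_Rintegral => s _.
  rewrite patchE; case: ifPn => //; rewrite notin_setE/= in_itv/= => /negP.
  by rewrite -ler_norml -ltNge => /(lt_trans MN)/FM[].
apply: reimP.
  apply: (main (fun t => Re (u t)) (fun t => Re (u' t))) => //.
    by move=> t; have [] := du t.
  by move=> t /uM[-> ->].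
apply: (main (fun t => Im (u t)) (fun t => Im (u' t))) => //.
  by move=> t; have [] := du t.
by move=> t /uM[-> ->].
Qed.

End line.

(** * The Fourier transform of a two-sided exponential *)

Section cutoff.
Variable R : realType.
Local Notation Re := (@complex.Re R).
Local Notation Im := (@complex.Im R).
Local Notation normc := (@Normc.normc R).
Local Notation leb := (@lebesgue_measure R).
Local Notation lmeasurable := (@cmeasurable _ (measurableTypeR R) R).

Definition cut (a b : R) (g : R -> R[i]) (s : R) : R[i] :=
  if s \in `[a, b] then g s else 0.

Let Re_cut a b g : (fun s => Re (cut a b g s)) = (fun s => Re (g s)) \_ `[a, b].
Proof.
by apply/funext => s; rewrite patchE /cut mem_setE; case: ifP.
Qed.

Let Im_cut a b g : (fun s => Im (cut a b g s)) = (fun s => Im (g s)) \_ `[a, b].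
Proof.
by apply/funext => s; rewrite patchE /cut mem_setE; case: ifP.
Qed.

Lemma cmeasurable_cut a b g : lmeasurable g -> lmeasurable (cut a b g).
Proof.
have mi : measurable (`[a, b]%classic : set (measurableTypeR R)) by exact: measurable_itv.
move=> [m1 m2]; split.
  rewrite Re_cut; apply/(@measurable_restrictT _ _ (measurableTypeR R) R _ (fun s => Re (g s)) mi).
  exact: measurable_funTS.
rewrite Im_cut; apply/(@measurable_restrictT _ _ (measurableTypeR R) R _ (fun s => Im (g s)) mi).
exact: measurable_funTS.
Qed.

Lemma cint_cut a b g : cint leb (cut a b g) =
  (\int[leb]_(s in `[a, b]) Re (g s)) +i* (\int[leb]_(s in `[a, b]) Im (g s)).
Proof.
apply: reimP.
  by rewrite re_cint [RHS]/= [RHS]Rintegral_mkcond; congr Rintegral; exact: Re_cut.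
by rewrite im_cint [RHS]/= [RHS]Rintegral_mkcond; congr Rintegral; exact: Im_cut.
Qed.

Lemma normc_cut a b g s : normc (cut a b g s) <= normc (g s).
Proof. by rewrite /cut; case: ifP => // _; rewrite Normc.normc0 normc_ge0. Qed.

Lemma cint_cut_ftc (u u' : R -> R[i]) a b : a < b ->
  (forall t, cderive u t (u' t)) -> ccontinuous u' ->
  cint leb (cut a b u') = u b - u a.
Proof.
move=> ab du [c1 c2]; rewrite cint_cut; apply: reimP; rewrite !(reD, imD, reN, imN)/=.
  by apply: (ftc_segment (F := fun t => Re (u t)) ab _ c1) => t; have [] := du t.
by apply: (ftc_segment (F := fun t => Im (u t)) ab _ c2) => t; have [] := du t.
Qed.

Lemma cint_cut_split (g : R -> R[i]) a b c : a <= b -> b <= c -> ccontinuous g ->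
  cint leb (cut a c g) = cint leb (cut a b g) + cint leb (cut b c g).
Proof.
move=> ab bc [c1 c2].
have main (f : R -> R) : continuous f -> \int[leb]_(s in `[a, c]) f s =
    \int[leb]_(s in `[a, b]) f s + \int[leb]_(s in `[b, c]) f s.
  move=> cf.
  have fi u v : leb.-integrable `[u, v] (EFin \o f).
    apply: continuous_compact_integrable; first exact: segment_compact.
    exact: continuous_subspaceT.
  have := @Rintegral_itvB _ f (BLeft a) (BRight c) b (fi a c).
  rewrite !bnd_simp => /(_ ab bc) h.
  have io : leb.-integrable `]b, c] (EFin \o f).
    by apply: integrableS (fi b c) => //; apply: subset_itvr; rewrite bnd_simp.
  have e := Rintegral_itv_obnd_cbnd io.
  by rewrite -[RHS]addrC; apply/eqP; rewrite -subr_eq; apply/eqP; exact: etrans h e.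
rewrite !cint_cut; apply: reimP; rewrite !(reD, imD)/=; exact: main.
Qed.

Lemma cint_cut_cvg (g : R -> R[i]) : lmeasurable g -> wbounded g ->
  ccvg (fun n => cint leb (cut (- n%:R) n%:R g)) (cint leb g).
Proof.
move=> mg [C gC]; apply: (cint_dominated (b := fun s => C * wt s)).
- by move=> n; exact: cmeasurable_cut.
- move=> s; have h : \forall n \near \oo, cut (- n%:R) n%:R g s = g s.
    near=> n; rewrite /cut in_itv/= -ler_norml ifT//.
    by near: n; exact: nbhs_infty_ger.
  split; apply: cvg_near_cst; by apply: filterS h => n ->.
- exact: integrable_wtZ.
- move=> n s; exact: le_trans (normc_cut _ _ _ _) (gC s).
Unshelve. all: by end_near. Qed.

End cutoff.

Section poisson.
Variable R : realType.
Local Notation Re := (@complex.Re R).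
Local Notation Im := (@complex.Im R).
Local Notation normc := (@Normc.normc R).
Local Notation leb := (@lebesgue_measure R).

Definition damp (e s : R) : R := expR (- (e * `|s|)).

Lemma damp_ge0 e s : 0 <= damp e s. Proof. exact: expR_ge0. Qed.

Lemma damp_le1 e s : 0 <= e -> damp e s <= 1.
Proof. by move=> e0; rewrite -expR0 ler_expR oppr_le0 mulr_ge0. Qed.

(** From 1 + y^2 / 2 <= e^y with y = e |s|. *)
Lemma damp_wt e s : 0 < e -> damp e s <= (1 + 2 / e ^+ 2) * wt s.
Proof.
move=> e0; rewrite /damp expRN /wt ler_pdivlMr// mulrC ler_pdivrMr ?expR_gt0//.
have h : 1 + (e * `|s|) ^+ 2 / 2 <= expR (e * `|s|).
  by have := @expR_ge1Dxn _ (e * `|s|) 1; apply; rewrite mulr_ge0// ltW.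
have h0 : 0 <= 1 + 2 / e ^+ 2 by rewrite addr_ge0// divr_ge0// sqr_ge0.
apply: le_trans (ler_wpM2l h0 h).
have -> : (1 + 2 / e ^+ 2) * (1 + (e * `|s|) ^+ 2 / 2) =
   oneDsqr s + ((e * `|s|) ^+ 2 / 2 + 2 / e ^+ 2).
  rewrite /oneDsqr exprMn real_normK ?num_real//; field.
  by rewrite gt_eqF.
by rewrite lerDl addr_ge0// divr_ge0// sqr_ge0.
Qed.

Lemma continuous_damp e : continuous (damp e).
Proof.
move=> s; apply: (cvg_comp (fun s => - (e * `|s|)) (@expR R)); last exact: continuous_expR.
by apply: cvgN; apply: cvgM; [exact: cvg_cst|apply: cvg_norm; exact: cvg_id].
Qed.

Lemma cvg_wt : wt n%:R @[n --> \oo] --> (0 : R).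
Proof.
apply: (@squeeze_cvgr _ _ _ _ (cst 0) (@harmonic R)); last exact: cvg_harmonic.
  apply: nearW => n; rewrite wt_ge0/= /wt /harmonic lef_pV2 ?posrE//.
  rewrite /oneDsqr -natr1 addrC lerD2l -natrX ler_nat.
  by case: n => // n; rewrite leq_pmulr.
exact: cvg_cst.
Qed.

(** On each half line the integrand is the derivative of
    e^(d s) cis (s u) / (d + i u), with d = e on the left and d = - e on the
    right.  The boundary terms at 0 add up to the value of the integral, those
    at infinity tend to 0. *)
Lemma damp_fourier (e u : R) : 0 < e ->
  cint leb (fun s => (damp e s)%:C * cis (s * u)) = (2 * e / (e ^+ 2 + u ^+ 2))%:C.
Proof.
move=> e0.
pose g s : R[i] := (damp e s)%:C * cis (s * u).
pose h (d s : R) : R[i] := (expR (d * s))%:C * cis (s * u).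
(* h d has derivative den d * h d, so that (den d)^-1 * h d is a primitive of it *)
pose den (d : R) : R[i] := d%:C + 'i%C * u%:C.
have den0 d : d != 0 -> den d != 0.
  move=> d0; apply/eqP => /(congr1 Re); rewrite /den !reimE/=.
  by rewrite mul0r mulr0 subr0 addr0; apply/eqP.
have dh d s : cderive (h d) s (den d * h d s).
  have h1 : is_derive s (1:R) (fun s => expR (d * s)) (d * expR (d * s)).
    apply: (@is_derive_eq _ _ _ (expR \o (d *: id))).
    by rewrite /GRing.scale/= mulr1 mulrC.
  have h2 : is_derive s (1:R) (fun s => s * u) u.
    have -> : (fun s => s * u) = u *: id by apply/funext => t; rewrite mulrC.
    apply: is_derive_eq; by rewrite /GRing.scale/= mulr1.
  have := cderiveM (cderive_real h1) (cderive_cis h2).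
  by move=> /cderive_eq; apply; rewrite /den /h rmorphM/=; ring.
have ch d : ccontinuous (h d) by exact: cderive_ccontinuous (dh d).
have cg : ccontinuous g.
  apply: ccontinuousM; last exact: ccontinuous_cis.
  exact/ccontinuous_real/continuous_damp.
have dH d s : d != 0 -> cderive (fun s => (den d)^-1 * h d s) s (h d s).
  move=> d0; have := cderiveM (cderive_cst (den d)^-1 s) (dh d s).
  by move=> /cderive_eq; apply; rewrite mul0r add0r mulrA mulVf ?mul1r// den0.
have e1 : e != 0 by rewrite gt_eqF.
have e2 : - e != 0 by rewrite oppr_eq0.
have gb s : normc (g s) <= (1 + 2 / e ^+ 2) * wt s.
  by rewrite Normc.normcM normc_cis mulr1 normc_real ger0_norm ?damp_ge0// damp_wt.
have h0 d : h d 0 = 1 by rewrite /h mulr0 mul0r expR0 cis0 mulr1.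
have val (n : nat) : cint leb (cut (- n.+1%:R) n.+1%:R g) =
   ((den e)^-1 - (den (- e))^-1) +
   ((den (- e))^-1 * g n.+1%:R - (den e)^-1 * g (- n.+1%:R)).
  rewrite (@cint_cut_split _ g _ 0) ?oppr_le0//.
  have -> : cut (- n.+1%:R) 0 g = cut (- n.+1%:R) 0 (h e).
    apply/funext => s; rewrite /cut; case: ifP => //; rewrite in_itv/= => /andP[_ s0].
    by rewrite /g /h /damp ler0_norm// mulrN opprK.
  have -> : cut 0 n.+1%:R g = cut 0 n.+1%:R (h (- e)).
    apply/funext => s; rewrite /cut; case: ifP => //; rewrite in_itv/= => /andP[s0 _].
    by rewrite /g /h /damp ger0_norm// mulNr.
  rewrite (cint_cut_ftc _ (fun s => dH e s e1) (ch e)) ?oppr_lt0//.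
  rewrite (cint_cut_ftc _ (fun s => dH (- e) s e2) (ch (- e)))//.
  have -> : g n.+1%:R = h (- e) n.+1%:R by rewrite /g /h /damp ger0_norm// mulNr.
  have -> : g (- n.+1%:R) = h e (- n.+1%:R).
    by rewrite /g /h /damp normrN ger0_norm// mulrN.
  by rewrite !h0 !mulr1; ring.
have shift (v : nat -> R) (l : R) : v n @[n --> \oo] --> l -> v n.+1 @[n --> \oo] --> l.
  by move=> hv; rewrite (cvg_shiftS v).
have lim1 : ccvg (fun n => cint leb (cut (- n.+1%:R) n.+1%:R g)) (cint leb g).
  have [l1 l2] := cint_cut_cvg (ccontinuous_cmeasurable cg) (ex_intro _ _ gb).
  by split; [exact: (shift _ _ l1)|exact: (shift _ _ l2)].
have wS : wt n.+1%:R @[n --> \oo] --> (0 : R) by exact: (shift _ _ cvg_wt).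
have wC : (1 + 2 / e ^+ 2) * wt n.+1%:R @[n --> \oo] --> (0 : R).
  rewrite -[X in _ --> X](mulr0 (1 + 2 / e ^+ 2)).
  by apply: cvgM => //; exact: cvg_cst.
have lim2 : ccvg (fun n => cint leb (cut (- n.+1%:R) n.+1%:R g))
    ((den e)^-1 - (den (- e))^-1 + (((den (- e))^-1 * 0) + (- (den e)^-1) * 0)).
  rewrite (funext val); apply: ccvgD; first exact: ccvg_cst.
  under eq_fun do rewrite -mulNr.
  apply: ccvgD; apply: ccvgM; try exact: ccvg_cst.
    by apply: (ccvg_normc0 _ wC) => n; exact: gb.
  apply: (ccvg_normc0 _ wC) => n; apply: le_trans (gb _) _.
  by rewrite /wt /oneDsqr sqrrN.
rewrite -[LHS]/(cint leb g) (ccvg_unique lim1 lim2) !mulr0 !addr0.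
have q0 : e ^+ 2 + u ^+ 2 != 0.
  by rewrite gt_eqF// ltr_pwDl ?sqr_ge0// exprn_gt0.
have qE : (e ^+ 2 + u ^+ 2)%:C = - (den e * den (- e)).
  by apply: reimP; rewrite /den !reimE !(mul0r, mul1r, mulr0, mulr1, add0r, addr0, subr0, sub0r); ring.
rewrite rmorphM/= fmorphV/= qE rmorphM/= rmorph_nat.
have -> : e%:C = (den e - den (- e)) / 2.
  by rewrite /den rmorphN/=; field.
by field; rewrite !den0.
Qed.

End poisson.

(** * Fourier inversion on the real line *)

Section plane.
Variable R : realType.
Local Notation Re := (@complex.Re R).
Local Notation Im := (@complex.Im R).
Local Notation normc := (@Normc.normc R).
Local Notation leb := (@lebesgue_measure R).
Local Notation leb2 := (leb \x leb)%E.

(** The dominating function is a product of integrable functions of one variable. *)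
Lemma plane_integrable (G : R * R -> R[i]) (C : R) :
  (forall s, ccontinuous (fun t => G (s, t))) ->
  (forall t, ccontinuous (fun s => G (s, t))) ->
  (forall s t, normc (G (s, t)) <= C * (wt s * wt t)) ->
  [/\ cintble leb2 G, forall s, cintble leb (fun t => G (s, t)) &
      forall t, cintble leb (fun s => G (s, t))].
Proof.
move=> c2 c1 GC; split.
- apply: (@cintble_dom _ _ _ leb2 G (fun p => C * (wt p.1 * wt p.2))).
  + split; apply: measurable_separately_continuous => s.
    * by have [] := c2 s.
    * by have [] := c1 s.
    * by have [] := c2 s.
    * by have [] := c1 s.
  + have h := @integrable_prod_dom _ _ _ _ _ leb leb _ _ (@wt_ge0 R) (@wt_ge0 R)
      (@integrable_wt R) (@integrable_wt R).
    by apply: eq_integrable (integrableZl _ C h).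
  + by move=> [s t]; exact: GC.
- move=> s; apply: cintble_wbounded; first exact/ccontinuous_cmeasurable.
  by exists (C * wt s) => t; rewrite -mulrA.
- move=> t; apply: cintble_wbounded; first exact/ccontinuous_cmeasurable.
  by exists (C * wt t) => s; rewrite mulrAC -mulrA.
Qed.

End plane.

Section inversion.
Variable R : realType.
Local Notation Re := (@complex.Re R).
Local Notation Im := (@complex.Im R).
Local Notation normc := (@Normc.normc R).
Local Notation leb := (@lebesgue_measure R).

Let eps (n : nat) : R := n.+1%:R^-1.

Let eps_gt0 n : 0 < eps n. Proof. by rewrite invr_gt0. Qed.

Let eps_cvg : eps n @[n --> \oo] --> (0 : R). Proof. exact: cvg_harmonic. Qed.

Let damp_cvg s : damp (eps n) s @[n --> \oo] --> (1 : R).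
Proof.
rewrite -[X in _ --> X](@expR0 R).
apply: (cvg_comp (fun n => - (eps n * `|s|)) (@expR R)); last exact: continuous_expR.
rewrite -oppr0 -(mul0r `|s|).
by apply: cvgN; apply: cvgM => //; exact: cvg_cst.
Qed.

(** The Poisson kernel, Fourier transform of [damp e]. *)
Definition pker (e u : R) : R := 2 * e / (e ^+ 2 + u ^+ 2).

Let pker_den (e u : R) : 0 < e -> 0 < e ^+ 2 + u ^+ 2.
Proof. by move=> e0; rewrite ltr_pwDl ?sqr_ge0// exprn_gt0. Qed.

Let pker_ge0 e u : 0 < e -> 0 <= pker e u.
Proof. by move=> e0; rewrite divr_ge0 ?mulr_ge0 ?ltW// pker_den. Qed.

(** This bound is uniform in e: it allows dominated convergence for
    (phi t - phi x) pker e (t - x) when phi is Lipschitz at x. *)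
Let pker_le e u : 0 < e -> `|u| * pker e u <= 1.
Proof.
move=> e0; rewrite /pker mulrA ler_pdivrMr ?pker_den// mul1r.
rewrite -(real_normK (num_real u)).
have := sqr_ge0 (e - `|u|); rewrite sqrrB -mulr_natl; lra.
Qed.

Let continuous_pker e x : 0 < e -> continuous (fun t => pker e (t - x)).
Proof.
move=> e0 t; apply: cvgM; first exact: cvg_cst.
apply: cvgV; first by rewrite gt_eqF// pker_den.
apply: cvgD; first exact: cvg_cst.
apply: (cvg_comp (fun t => t - x) (fun t => t ^+ 2)); last exact: exprn_continuous.
by apply: cvgB; [exact: cvg_id|exact: cvg_cst].
Qed.

Let pker_cvg u : u != 0 -> pker (eps n) u @[n --> \oo] --> (0 : R).
Proof.
move=> u0.
have u2 : u ^+ 2 != 0 by rewrite expf_neq0.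
have -> : (0 : R) = 2 * 0 / (0 ^+ 2 + u ^+ 2) by rewrite mulr0 mul0r.
apply: cvgM; first by apply: cvgM => //; exact: cvg_cst.
apply: cvgV; first by rewrite expr0n add0r.
apply: cvgD; last exact: cvg_cst.
exact: (cvg_comp eps (fun t => t ^+ 2) eps_cvg (@exprn_continuous _ 2 0)).
Qed.

Let pker_antiderivative e x t : 0 < e ->
  is_derive t (1:R) (fun t => 2 * atan ((t - x) / e)) (pker e (t - x)).
Proof.
move=> e0.
have h : is_derive t (1:R) (fun t : R => (t - x) / e) e^-1.
  have -> : (fun t : R => (t - x) / e) = e^-1 *: (id - cst x).
    by apply/funext => s; rewrite mulrC.
  by apply: is_derive_eq; rewrite subr0 /GRing.scale/= mulr1.
apply: (@is_derive_eq _ _ _ (2 *: (@atan R \o (fun t => (t - x) / e)))).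
rewrite /GRing.scale/= /pker.
have := pker_den (t - x) e0; have := e0 => /gt_eqF e1 /gt_eqF e2.
by field; rewrite e1 e2.
Qed.

Let atan_cvg a : 0 < a -> atan (a / eps n) @[n --> \oo] --> (pi / 2 : R).
Proof.
move=> a0; apply: (cvg_comp (fun n => a / eps n) (@atan R)); last exact: cvgy_atan.
apply/cvgryPge => A; near=> n.
rewrite /eps invrK mulrC -ler_pdivrMr//.
rewrite (@le_trans _ _ n%:R)//; last by rewrite ler_nat.
by near: n; exact: nbhs_infty_ger.
Unshelve. all: by end_near. Qed.

Variables (phi : R -> R[i]) (M L B x : R).
Hypothesis phi_cont : ccontinuous phi.
Hypothesis phi0 : forall t, M < `|t| -> phi t = 0.
Hypothesis phi_le : forall t, normc (phi t) <= B.
Hypothesis phi_lip : forall t, normc (phi t - phi x) <= L * `|t - x|.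

Let hat s := cint leb (fun t => cis (t * s) * phi t).
Hypothesis hat_cont : ccontinuous hat.
Hypothesis hat_wb : wbounded hat.

Let J n := cint leb (fun s => (damp (eps n) s)%:C * (cis (- (x * s)) * hat s)).

Let ccont_cisN : ccontinuous (fun s : R => cis (- (x * s))).
Proof.
have -> : (fun s : R => cis (- (x * s))) = (fun s => cis (s * (- x))).
  by apply/funext => s; rewrite mulrN mulrC.
exact: ccontinuous_cis.
Qed.

Let J_cvg : ccvg J (cint leb (fun s => cis (- (x * s)) * hat s)).
Proof.
have [C hC] := hat_wb.
apply: (@cint_dominated _ _ _ (fun s => C * wt s)).
- move=> n; apply: ccontinuous_cmeasurable.
  apply: ccontinuousM; first exact/ccontinuous_real/continuous_damp.
  exact: ccontinuousM.
- move=> s; rewrite -[X in ccvg _ X]mul1r.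
  apply: ccvgM; last exact: ccvg_cst.
  exact: (ccvg_real (damp_cvg s)).
- exact: integrable_wtZ.
- move=> n s; rewrite !Normc.normcM normc_cis mul1r normc_real.
  rewrite ger0_norm ?damp_ge0//; apply: le_trans (hC s).
  by rewrite ler_piMl ?normc_ge0// damp_le1// ltW.
Qed.

(** Fubini: integrating first in the frequency s yields the Poisson kernel. *)
Let J_poisson n : J n = cint leb (fun t => phi t * (pker (eps n) (t - x))%:C).
Proof.
have [C1 hC1] := wbounded_compact phi_le phi0.
have e0 := eps_gt0 n.
pose C2 := 1 + 2 / eps n ^+ 2.
have C20 : 0 <= C2 by rewrite addr_ge0// divr_ge0// sqr_ge0.
pose G (p : R * R) := phi p.2 * ((damp (eps n) p.1)%:C * cis (p.1 * (p.2 - x))).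
have cd : ccontinuous (fun s => (damp (eps n) s)%:C) by exact/ccontinuous_real/continuous_damp.
have [] := @plane_integrable _ G (C1 * C2).
- move=> s; rewrite /G/=; apply: ccontinuousM => //.
  apply: ccontinuousM; first exact: ccontinuous_cst.
  have -> : (fun t => cis (s * (t - x))) = (fun t => cis (t * s) * cis (- (s * x))).
    by apply/funext => t; rewrite -cisD mulrBr [t * s]mulrC.
  by apply: ccontinuousM; [exact: ccontinuous_cis|exact: ccontinuous_cst].
- move=> t; rewrite /G/=; apply: ccontinuousM; first exact: ccontinuous_cst.
  by apply: ccontinuousM => //; exact: ccontinuous_cis.
- move=> s t; rewrite !Normc.normcM normc_cis mulr1 normc_real ger0_norm ?damp_ge0//.
  have -> : C1 * C2 * (wt s * wt t) = (C1 * wt t) * (C2 * wt s) by ring.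
  apply: ler_pM; rewrite ?normc_ge0 ?damp_ge0 ?hC1//; exact: damp_wt.
move=> iG iG1 iG2.
transitivity (cint leb (fun s => cint leb (fun t => G (s, t)))).
  apply: eq_cint => s; rewrite /hat mulrA -cintZ; last first.
    apply: cintble_wbounded.
      apply: ccontinuous_cmeasurable; apply: ccontinuousM => //; exact: ccontinuous_cis.
    by exists C1 => t; rewrite Normc.normcM normc_cis mul1r.
  apply: eq_cint => t; rewrite /G/=.
  have -> : cis (s * (t - x)) = cis (- (x * s)) * cis (t * s).
    by rewrite -cisD; congr cis; ring.
  ring.
rewrite -(cint_prod12 iG iG1) (cint_prod21 iG iG2).
apply: eq_cint => t; rewrite /G/= cintZ ?damp_fourier//.
apply: cintble_wbounded.
  apply: ccontinuous_cmeasurable; apply: ccontinuousM => //; exact: ccontinuous_cis.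
exists C2 => s; rewrite Normc.normcM normc_cis mulr1 normc_real.
by rewrite ger0_norm ?damp_ge0// damp_wt.
Qed.

Let N : R := `|M| + `|x| + 1.

(** On a bounded interval around x, phi t is written as (phi t - phi x) + phi x.
    The first part tends to 0 by [pker_le] and dominated convergence, the kernel
    itself has total mass close to 2 pi by its primitive 2 atan ((t - x) / e). *)
Let K_cvg : ccvg (fun n => cint leb (fun t => phi t * (pker (eps n) (t - x))%:C))
  ((2 * pi)%:C * phi x).
Proof.
(* N exceeds |M| and |x|: the segment [- N, N] contains the support of phi and
   has x in its interior *)
have N0 : 0 < N by rewrite ltr_wpDl// addr_ge0.
have NN : - N < N by rewrite (lt_trans _ N0)// oppr_lt0.
have xN : 0 < N - x by rewrite subr_gt0 /N; have := ler_norm x; have := normr_ge0 M; lra.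
have xN' : 0 < N + x by rewrite /N; have := ler_norm (- x); rewrite normrN; have := normr_ge0 M; lra.
have MN t : t \notin `[- N, N] -> phi t = 0.
  rewrite in_itv/= -ler_norml -ltNge => tN; apply: phi0; apply: le_lt_trans tN.
  by rewrite /N; have := ler_norm M; have := normr_ge0 x; lra.
pose K n t : R[i] := (pker (eps n) (t - x))%:C.
have cK n : ccontinuous (K n) by exact/ccontinuous_real/continuous_pker.
pose D n t : R[i] := (phi t - phi x) * K n t.
have cD n : ccontinuous (D n).
  apply: ccontinuousM => //; have [h1 h2] := phi_cont; split => t.
    by under eq_fun do rewrite reD; apply: cvgD; [exact: h1|exact: cvg_cst].
  by under eq_fun do rewrite imD; apply: cvgD; [exact: h2|exact: cvg_cst].
have wT (g : R -> R[i]) (b : R) : (forall t, normc (g t) <= b) -> wbounded (cut (- N) N g).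
  move=> gb; apply: (@wbounded_compact _ _ b N).
    by move=> t; exact: le_trans (normc_cut _ _ _ _) (gb t).
  by move=> t Nt; rewrite /cut in_itv/= -ler_norml leNgt Nt.
have DL n t : normc (D n t) <= `|L|.
  rewrite Normc.normcM normc_real ger0_norm ?pker_ge0//.
  have pk := pker_ge0 (t - x) (eps_gt0 n).
  apply: le_trans (ler_wpM2r pk (phi_lip t)) _.
  rewrite -mulrA; apply: (@le_trans _ _ (`|L| * (`|t - x| * pker (eps n) (t - x)))).
    by apply: ler_wpM2r (ler_norm L); rewrite mulr_ge0.
  by rewrite ler_piMr// pker_le.
have split_phi n : (fun t => phi t * (pker (eps n) (t - x))%:C) =
    (fun t => cut (- N) N (D n) t + phi x * cut (- N) N (K n) t).
  apply/funext => t; rewrite /cut; case: ifPn => [_|/MN ->].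
    by rewrite /D /K -mulrDl subrK.
  by rewrite mulr0 mul0r addr0.
have iD n : cintble leb (cut (- N) N (D n)).
  apply: cintble_wbounded; first exact/cmeasurable_cut/ccontinuous_cmeasurable.
  exact: wT (DL n).
have iK n : cintble leb (cut (- N) N (K n)).
  apply: cintble_wbounded; first exact/cmeasurable_cut/ccontinuous_cmeasurable.
  apply: (wT _ (2 / eps n)) => t; rewrite normc_real ger0_norm ?pker_ge0//.
  have e0 := eps_gt0 n.
  rewrite /pker ler_pdivrMr ?pker_den// -mulrA ler_pM2l// -ler_pdivrMl ?invr_gt0//.
  by rewrite invrK -expr2 lerDl sqr_ge0.
have -> : (2 * pi)%:C * phi x = 0 + phi x * (2 * pi)%:C by rewrite add0r mulrC.
have vE n : cint leb (fun t => phi t * (pker (eps n) (t - x))%:C) =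
    cint leb (cut (- N) N (D n)) + phi x * cint leb (cut (- N) N (K n)).
  by rewrite split_phi cintD ?cintZ//; exact: cintbleZ.
rewrite (funext vE).
apply: ccvgD; last (apply: ccvgM; first exact: ccvg_cst).
- have [|C hC] := wT (fun=> `|L|%:C) `|L|.
    by move=> t; rewrite normc_real normr_id.
  rewrite -[X in ccvg _ X](@cint0 _ _ R leb).
  apply: (@cint_dominated _ (fun n => cut (- N) N (D n)) (fun=> 0) (fun s => C * wt s)).
  + by move=> n; exact/cmeasurable_cut/ccontinuous_cmeasurable.
  + move=> t; rewrite /cut; case: (t \in `[- N, N]); last exact: ccvg_cst.
    have [->|tx] := eqVneq t x.
      rewrite /D; under eq_fun do rewrite subrr mul0r; exact: ccvg_cst.
    rewrite -(mulr0 (phi t - phi x)); apply: ccvgM; first exact: ccvg_cst.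
    by apply: ccvg_real; apply: pker_cvg; rewrite subr_eq0.
  + exact: integrable_wtZ.
  + move=> n t; apply: le_trans (hC t); rewrite /cut; case: ifP => // _.
    by rewrite normc_real normr_id DL.
- have -> : (fun n => cint leb (cut (- N) N (K n))) =
     (fun n => (2 * atan ((N - x) / eps n) + 2 * atan ((N + x) / eps n))%:C).
    apply/funext => n.
    rewrite (@cint_cut_ftc _ (fun t => (2 * atan ((t - x) / eps n))%:C))//; last first.
      by move=> t; apply: cderive_real; exact: pker_antiderivative.
    by rewrite -opprD mulNr atanN mulrN rmorphN/= opprK -rmorphD.
  apply: ccvg_real; have -> : 2 * pi = 2 * (pi / 2) + 2 * (pi / 2) :> R by field.
  by apply: cvgD; apply: cvgM; try exact: cvg_cst; exact: atan_cvg.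
Qed.

(** Fourier inversion at one point x, for a continuous function with bounded support
    that is Lipschitz at x and has an integrable transform.  Both [J_cvg] and
    [K_cvg] compute the limit of the damped inversion integrals J n: the first
    by removing the damping, the second after exchanging the integrals, when
    phi is integrated against the Poisson kernel. *)
Lemma fourier_inversion_line : cint leb (fun s => cis (- (x * s)) * hat s) = (2 * pi)%:C * phi x.
Proof.
apply: (ccvg_unique J_cvg); rewrite (funext J_poisson).
exact: K_cvg.
Qed.

End inversion.

(** * The Fourier transform in one real coordinate *)

Section one_variable_transform.
Variable R : realType.
Implicit Types (x : 'rV[R]_4) (j k : 'I_4) (f g : 'rV[R]_4 -> R[i]).
Local Notation Re := (@complex.Re R).
Local Notation Im := (@complex.Im R).
Local Notation normc := (@Normc.normc R).
Local Notation leb := (@lebesgue_measure R).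
Local Notation evec := (@evec R).

Definition coord_ft_integrand j f x (t : R) : R[i] := cis (t * x 0 j) * f (upd j t x).

(** Unnormalized Fourier transform in the j-th coordinate, with the sign of the
    inverse transform; the frequency and the dual variable share the slot j. *)
Definition coord_ft j f x : R[i] := cint leb (coord_ft_integrand j f x).

(** The functions on which [coord_ft j] is well behaved: their support lies in a
    slab |x_j| <= M. *)
Definition slab j f : Prop := bsmooth f /\ vanish j f.

Lemma slab_pder j k f : slab j f -> slab j (pder k f).
Proof. by move=> [h1 h2]; split; [exact: bsmooth_pder|exact: vanish_pder]. Qed.

Lemma slabD j f g : slab j f -> slab j g -> slab j (fun x => f x + g x).
Proof. by move=> [h1 h2] [h3 h4]; split; [exact: bsmoothD|exact: vanishD]. Qed.

Lemma slabZ j c f : slab j f -> slab j (fun x => c * f x).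
Proof. by move=> [h1 h2]; split; [exact: bsmoothZ|exact: vanishMl]. Qed.

Lemma slab_coordM j k f : slab j f -> vanish k f -> slab j (fun x => (x 0 k)%:C * f x).
Proof. by move=> [h1 h2] h; split; [exact: bsmooth_coordM|exact: vanishMl]. Qed.

Lemma bsmooth_upd_ccontinuous j f x : bsmooth f -> ccontinuous (fun t => f (upd j t x)).
Proof.
move=> fs; apply: cderive_ccontinuous => t.
by apply: cderive_upd; exact: bsmooth_pdiff.
Qed.

Lemma slab_wt j f : slab j f -> exists C, forall x t, normc (f (upd j t x)) <= C * wt t.
Proof.
move=> [fs [M fM]]; have [B fB] := bsmooth_bounded fs.
have B0 : 0 <= B by exact: le_trans (normc_ge0 _) (fB 0).
(* the cut-off constant B dominates f on all lines in direction j at once *)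
have [C hC] : wbounded (cut (- `|M|) `|M| (fun=> B%:C)).
  apply: (@wbounded_compact _ _ B `|M|) => s.
    by apply: le_trans (normc_cut _ _ _ _) _; rewrite normc_real ger0_norm.
  by move=> Ms; rewrite /cut in_itv/= -ler_norml leNgt Ms.
exists C => x t; apply: le_trans (hC t).
rewrite /cut in_itv/= -ler_norml; case: ifPn => [_|]; last rewrite -ltNge => Mt.
  by rewrite normc_real ger0_norm.
by rewrite fM ?Normc.normc0// upd_same (le_lt_trans (ler_norm M)).
Qed.

Lemma coord_ft_wbounded j f x : slab j f -> wbounded (coord_ft_integrand j f x).
Proof.
by move=> /slab_wt[C hC]; exists C => t; rewrite Normc.normcM normc_cis mul1r.
Qed.

Lemma coord_ft_ccontinuous j f x : slab j f -> ccontinuous (coord_ft_integrand j f x).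
Proof.
move=> [fs _]; apply: ccontinuousM; first exact: ccontinuous_cis.
exact: bsmooth_upd_ccontinuous.
Qed.

Lemma coord_ft_cintble j f x : slab j f -> cintble leb (coord_ft_integrand j f x).
Proof.
move=> fj; apply: cintble_wbounded; last exact: coord_ft_wbounded.
exact/ccontinuous_cmeasurable/coord_ft_ccontinuous.
Qed.

Lemma coord_ft_bounded j f : slab j f -> cbounded (coord_ft j f).
Proof.
move=> fj; have [C hC] := slab_wt fj.
exists (2 * \int[leb]_t (C * wt t)) => x.
apply: normc_cint; first exact: coord_ft_cintble.
  exact: integrable_wtZ.
by move=> t; rewrite Normc.normcM normc_cis mul1r.
Qed.

Lemma coord_ftD j f g x : slab j f -> slab j g ->
  coord_ft j (fun y => f y + g y) x = coord_ft j f x + coord_ft j g x.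
Proof.
move=> hf hg; rewrite /coord_ft -cintD; try exact: coord_ft_cintble.
by apply: eq_cint => t; rewrite /coord_ft_integrand mulrDr.
Qed.

Lemma coord_ftZ j c f x : slab j f -> coord_ft j (fun y => c * f y) x = c * coord_ft j f x.
Proof.
move=> hf; rewrite /coord_ft -cintZ; last exact: coord_ft_cintble.
by apply: eq_cint => t; rewrite /coord_ft_integrand mulrCA.
Qed.

Lemma coord_ft_coordM j k f x : k != j -> slab j f ->
  coord_ft j (fun y => (y 0 k)%:C * f y) x = (x 0 k)%:C * coord_ft j f x.
Proof.
move=> kj hf; rewrite /coord_ft -cintZ; last exact: coord_ft_cintble.
by apply: eq_cint => t; rewrite /coord_ft_integrand mulrCA upd_other.
Qed.

Lemma vanish_coord_ft j k f : k != j -> vanish k f -> vanish k (coord_ft j f).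
Proof.
move=> kj [M fM]; exists M => x Mx; rewrite /coord_ft -(@cint0 _ _ R leb).
by apply: eq_cint => t; rewrite /coord_ft_integrand fM ?mulr0// upd_other.
Qed.

Lemma pder_coord_ft_other j k f x : k != j -> slab j f ->
  pdiff k (coord_ft j f) x /\ pder k (coord_ft j f) x = coord_ft j (pder k f) x.
Proof.
move=> kj fj; have [fs _] := fj.
apply: pderE; have gj := slab_pder k fj; have [C hC] := slab_wt gj.
have eqk (g : 'rV[R]_4 -> R[i]) t s :
    coord_ft_integrand j g (x + t *: evec k) s = cis (s * x 0 j) * g (upd j s x + t *: evec k).
  by rewrite /coord_ft_integrand line_coord eq_sym (negbTE kj) mulr0 addr0 upd_line_other.
have := @cderive_cint R (fun t s => coord_ft_integrand j f (x + t *: evec k) s)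
  (fun t s => coord_ft_integrand j (pder k f) (x + t *: evec k) s) C 0.
rewrite scale0r addr0; apply.
- by move=> t; exact: coord_ft_cintble.
- move=> t s; rewrite eqk; under eq_fun do rewrite eqk.
  have h := @cderive_line _ f (upd j s x) k t (bsmooth_pdiff _ _ fs).
  have := cderiveM (cderive_cst (cis (s * x 0 j)) t) h.
  by rewrite mul0r add0r.
- by move=> t s; rewrite Normc.normcM normc_cis mul1r.
Qed.

(** The integrand depends on x_j only through the exponential. *)
Lemma pder_coord_ft_same j f x : slab j f ->
  pdiff j (coord_ft j f) x /\
  pder j (coord_ft j f) x = coord_ft j (fun y => 'i%C * ((y 0 j)%:C * f y)) x.
Proof.
move=> fj; have [fs fv] := fj.
have gj : slab j (fun y => 'i%C * ((y 0 j)%:C * f y)) by exact/slabZ/slab_coordM.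
have [C hC] := slab_wt gj.
apply: pderE.
have eqk (g : 'rV[R]_4 -> R[i]) t s :
    coord_ft_integrand j g (x + t *: evec j) s = cis (s * (x 0 j + t)) * g (upd j s x).
  by rewrite /coord_ft_integrand line_coord eqxx mulr1 upd_line.
have := @cderive_cint R (fun t s => coord_ft_integrand j f (x + t *: evec j) s)
  (fun t s => coord_ft_integrand j (fun y => 'i%C * ((y 0 j)%:C * f y)) (x + t *: evec j) s) C 0.
rewrite scale0r addr0; apply.
- by move=> t; exact: coord_ft_cintble.
- move=> t s; rewrite eqk; under eq_fun do rewrite eqk.
  rewrite upd_same.
  have h : is_derive t (1:R) (fun t => s * (x 0 j + t)) s.
    apply: (@is_derive_eq _ _ _ (s *: (cst (x 0 j) + id))).
    by rewrite add0r /GRing.scale/= mulr1.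
  have := cderiveM (cderive_cis h) (cderive_cst (f (upd j s x)) t).
  by move=> /cderive_eq; apply; rewrite mulr0 addr0; ring.
- by move=> t s; rewrite Normc.normcM normc_cis mul1r.
Qed.

Lemma bsmooth_coord_ft j f : slab j f -> bsmooth (coord_ft j f).
Proof.
move=> fj.
apply: (@bsmooth_coind _ (fun g => exists2 f, slab j f & g = coord_ft j f)); last by exists f.
move=> _ {fj}[{}f fj ->]; split.
- exact: coord_ft_bounded.
- move=> x k; have [->|kj] := eqVneq k j; first by have [] := pder_coord_ft_same x fj.
  by have [] := pder_coord_ft_other x kj fj.
- move=> k; have [->|kj] := eqVneq k j.
    exists (fun y : 'rV[R]_4 => 'i%C * ((y 0 j)%:C * f y)); last first.
      by apply/funext => x; have [] := pder_coord_ft_same x fj.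
    by apply/slabZ/slab_coordM => //; have [] := fj.
  exists (pder k f); first exact: slab_pder.
  by apply/funext => x; have [] := pder_coord_ft_other x kj fj.
Qed.

(** The integral of the derivative of e^(i t x_j) f in the variable t is 0. *)
Lemma coord_ft_ibp j f x : slab j f ->
  (x 0 j)%:C * coord_ft j f x = coord_ft j (fun y => 'i%C * pder j f y) x.
Proof.
move=> fj; have [fs [M fM]] := fj.
have gj : slab j (fun y => 'i%C * pder j f y) by exact/slabZ/slab_pder.
(* the derivative of the integrand in t *)
pose u' t := 'i%C * (x 0 j)%:C * coord_ft_integrand j f x t + coord_ft_integrand j (pder j f) x t.
have du t : cderive (coord_ft_integrand j f x) t (u' t).
  have h : is_derive t (1:R) (fun t => t * x 0 j) (x 0 j).
    have -> : (fun s => s * x 0 j) = x 0 j *: id by apply/funext => s; rewrite mulrC.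
    by apply: is_derive_eq; rewrite /GRing.scale/= mulr1.
  have := cderiveM (cderive_cis h) (@cderive_upd _ f x j t (bsmooth_pdiff _ _ fs)).
  by move=> /cderive_eq; apply; rewrite /u' /coord_ft_integrand mulrA.
have [N gN] := vanish_pder j (ex_intro _ M fM).
have ikf := coord_ft_cintble x fj.
have ikp := coord_ft_cintble x (slab_pder j fj).
have cu' : ccontinuous u'.
  have [h1 h2] := ccontinuousM (ccontinuous_cst ('i%C * (x 0 j)%:C)) (coord_ft_ccontinuous x fj).
  have [h3 h4] := coord_ft_ccontinuous x (slab_pder j fj).
  split => t.
    by under eq_fun do rewrite reD; apply: cvgD; [exact: h1|exact: h3].
  by under eq_fun do rewrite imD; apply: cvgD; [exact: h2|exact: h4].
have : cint leb u' = 0.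
  apply: (@cint_derive_compact _ (coord_ft_integrand j f x) u' (Num.max M N)) => // t.
  rewrite gt_max => /andP[Mt Nt]; rewrite /u' /coord_ft_integrand fM ?upd_same// gN ?upd_same//.
  by rewrite !mulr0 addr0.
rewrite /u' cintD ?cintZ//; last exact: cintbleZ.
rewrite -/(coord_ft j f x) -/(coord_ft j (pder j f) x) (coord_ftZ _ _ (slab_pder j fj)) => h.
apply/eqP; rewrite -subr_eq0; apply/eqP.
have i2 : 'i%C * 'i%C = -1 :> R[i] by rewrite -expr2 sqr_i.
transitivity (- ('i%C * 'i%C * ((x 0 j)%:C * coord_ft j f x) + 'i%C * coord_ft j (pder j f) x)).
  by rewrite i2; ring.
by rewrite -!mulrA -mulrDr !mulrA h mulr0 oppr0.
Qed.

(** (1 + x_j^2) times the transform of f is the transform of f minus its second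
    derivative in x_j, hence bounded. *)
Lemma coord_ft_wt j f : slab j f ->
  exists C, forall x s, normc (coord_ft j f (upd j s x)) <= C * wt s.
Proof.
move=> fj.
have f1 : slab j (fun y => 'i%C * pder j f y) by exact/slabZ/slab_pder.
pose f2 := fun y => 'i%C * pder j (fun y => 'i%C * pder j f y) y.
have f2j : slab j f2 by exact/slabZ/slab_pder.
have [C hC] := coord_ft_bounded (slabD fj f2j).
exists C => x s; set y := upd j s x.
have := hC y; rewrite (coord_ftD _ fj f2j) -(coord_ft_ibp _ f1) -(coord_ft_ibp _ fj).
have -> : coord_ft j f y + (y 0 j)%:C * ((y 0 j)%:C * coord_ft j f y) =
    (oneDsqr s)%:C * coord_ft j f y.
  by rewrite upd_same /oneDsqr rmorphD rmorphXn/=; ring.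
by rewrite Normc.normcM normc_real ger0_norm// /wt ler_pdivlMr// mulrC.
Qed.

Lemma coord_ft_inversion j f x : slab j f ->
  cint leb (fun s => cis (- (x 0 j * s)) * coord_ft j f (upd j s x)) = (2 * pi)%:C * f x.
Proof.
move=> fj; have [fs [M fM]] := fj.
have [B fB] := bsmooth_bounded fs.
have [B' fB'] := bsmooth_bounded (bsmooth_pder j fs).
have Ehat s : coord_ft j f (upd j s x) = cint leb (fun t => cis (t * s) * f (upd j t x)).
  by apply: eq_cint => t; rewrite /coord_ft_integrand upd_same upd_upd.
have := @fourier_inversion_line R (fun t => f (upd j t x)) M (2 * B') B (x 0 j).
rewrite upd_id => <-.
- by apply: eq_cint => s; rewrite Ehat.
- exact: bsmooth_upd_ccontinuous.
- by move=> t Mt; rewrite fM// upd_same.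
- by [].
- move=> t.
  have dl s := @cderive_line _ f x j s (bsmooth_pdiff _ _ fs).
  apply: le_trans (normc_le _) _.
  rewrite !(reD, imD, reN, imN) mulr_natl mulr2n mulrDl; apply: lerD.
    have := @mvt_abs _ (fun s => Re (f (x + s *: evec j)))
      (fun s => Re (pder j f (x + s *: evec j))) B' (t - x 0 j).
    rewrite scale0r addr0; apply.
      by move=> s; have [] := dl s.
    by move=> s _; exact: le_trans (re_le_normc _) (fB' _).
  have := @mvt_abs _ (fun s => Im (f (x + s *: evec j)))
    (fun s => Im (pder j f (x + s *: evec j))) B' (t - x 0 j).
  rewrite scale0r addr0; apply.
    by move=> s; have [] := dl s.
  by move=> s _; exact: le_trans (im_le_normc _) (fB' _).
- under eq_fun do rewrite -Ehat; apply: bsmooth_upd_ccontinuous; exact: bsmooth_coord_ft.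
- have [C hC] := coord_ft_wt fj; exists C => s; rewrite -Ehat; exact: hC.
Qed.

End one_variable_transform.

(** * The partial Fourier transform and its inversion *)

Section partial_fourier.
Variable R : realType.
Implicit Types (x : 'rV[R]_4) (j k : 'I_4) (f g : 'rV[R]_4 -> R[i]).
Local Notation Re := (@complex.Re R).
Local Notation Im := (@complex.Im R).
Local Notation normc := (@Normc.normc R).
Local Notation leb := (@lebesgue_measure R).
Local Notation leb2 := (leb \x leb)%E.
Local Notation j0 := (0 : 'I_4).
Local Notation j2 := (2%R : 'I_4).

(** The functions on the plane of frequencies in the definitions of the transforms
    are obtained by updating the coordinates 0 and 2. *)
Lemma point_upd (s t : R) x : Defs.point (s +i* t) (coord2 x) = upd j0 s (upd j2 t x).
Proof.
apply/rowP => k; rewrite !updE mxE.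
case: k => [[|[|[|[|//]]]] hk] //=; by congr (x 0 _); apply/val_inj.
Qed.

(** The class of functions of (xi, w) replacing the test functions: the support is
    bounded in the two real coordinates of xi, which is all that an integral over
    xi at fixed w sees. *)
Definition tube f : Prop := [/\ bsmooth f, vanish j0 f & vanish j2 f].
Lemma tube_slab f : tube f -> slab j2 f. Proof. by case. Qed.

Lemma tube_pder k f : tube f -> tube (pder k f).
Proof. by case=> h1 h2 h3; split; [exact: bsmooth_pder|exact: vanish_pder..]. Qed.

Lemma tubeZ c f : tube f -> tube (fun x => c * f x).
Proof. by case=> h1 h2 h3; split; [exact: bsmoothZ|exact: vanishMl..]. Qed.

Lemma tubeD f g : tube f -> tube g -> tube (fun x => f x + g x).
Proof.
by case=> h1 h2 h3 [h4 h5 h6]; split; [exact: bsmoothD|exact: vanishD..].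
Qed.

Lemma tube_coordM k f : (k == j0) || (k == j2) -> tube f -> tube (fun x => (x 0 k)%:C * f x).
Proof.
move=> hk [h1 h2 h3]; split; [|exact: vanishMl..].
by case/orP: hk => /eqP ->; exact: bsmooth_coordM.
Qed.

Lemma tube_coord_ft f : tube f -> slab j0 (coord_ft j2 f).
Proof.
by case=> h1 h2 h3; split; [exact: bsmooth_coord_ft|exact: vanish_coord_ft].
Qed.

Lemma tube_wt f : tube f -> exists C, forall x s t,
  normc (f (upd j0 s (upd j2 t x))) <= C * (wt s * wt t).
Proof.
move=> [fs [M fM] [N fN]]; have [B fB] := bsmooth_bounded fs.
have B0 : 0 <= B by exact: le_trans (normc_ge0 _) (fB 0).
have ind (L : R) : exists2 C : R, 0 <= C & forall s, `|s| <= L -> 1 <= C * wt s.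
  have [C hC] : wbounded (cut (- L) L (fun=> 1%:C)).
    apply: (@wbounded_compact _ _ 1 L) => s.
      by apply: le_trans (normc_cut _ _ _ _) _; rewrite normc_real normr1.
    by move=> Ms; rewrite /cut in_itv/= -ler_norml leNgt Ms.
  have hC' s : `|s| <= L -> 1 <= C * wt s.
    move=> sL; have := hC s; have -> : cut (- L) L (fun=> 1%:C) s = 1%:C :> R[i].
      by rewrite /cut in_itv/= -ler_norml sL.
    by rewrite normc_real normr1.
  exists C => //; rewrite -(@pmulr_lge0 _ (wt 0)) ?wt_gt0//.
  exact: le_trans (normc_ge0 _) (hC 0).
have [C1 C10 h1] := ind M; have [C2 C20 h2] := ind N.
exists (B * C1 * C2) => x s t.
have -> : B * C1 * C2 * (wt s * wt t) = B * ((C1 * wt s) * (C2 * wt t)) by ring.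
have C1s : 0 <= C1 * wt s by rewrite mulr_ge0 ?wt_ge0.
have C2t : 0 <= C2 * wt t by rewrite mulr_ge0 ?wt_ge0.
have [sM|Ms] := lerP `|s| M; last first.
  have -> : f (upd j0 s (upd j2 t x)) = 0 by apply: fM; rewrite upd_same.
  by rewrite Normc.normc0 mulr_ge0// mulr_ge0.
have [tN|Nt] := lerP `|t| N; last first.
  have -> : f (upd j0 s (upd j2 t x)) = 0 by apply: fN; rewrite upd_other// upd_same.
  by rewrite Normc.normc0 mulr_ge0// mulr_ge0.
apply: le_trans (fB _) _; rewrite ler_peMr//.
by rewrite -[leLHS]mulr1; apply: ler_pM; rewrite ?h1 ?h2.
Qed.

(** The weights in both variables are gained one after the other: the factor
    1 + t^2 is absorbed by f minus its second derivative in the coordinate 2,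
    and the bound [coord_ft_wt] in the coordinate 0 applies to the result. *)
Lemma coord_ft2_wt f : tube f -> exists C, forall x s t,
  normc (coord_ft j0 (coord_ft j2 f) (upd j0 s (upd j2 t x))) <= C * (wt s * wt t).
Proof.
move=> f2.
have g2 : tube (fun y => 'i%C * pder j2 f y) by exact/tubeZ/tube_pder.
(* h = - d^2 f / dx_2^2, whose transform is x_2^2 times the one of f *)
pose h := fun y => 'i%C * pder j2 (fun y => 'i%C * pder j2 f y) y.
have h2 : tube h by exact/tubeZ/tube_pder.
have [C hC] := coord_ft_wt (tube_coord_ft (tubeD f2 h2)).
exists C => x s t; set y := upd _ _ _.
have := hC (upd j2 t x) s; rewrite -/y.
have -> : coord_ft j0 (coord_ft j2 (fun y => f y + h y)) y =
    (oneDsqr t)%:C * coord_ft j0 (coord_ft j2 f) y.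
  have -> : coord_ft j2 (fun y => f y + h y) =
    (fun y => coord_ft j2 f y + (y 0 j2)%:C * ((y 0 j2)%:C * coord_ft j2 f y)).
    apply/funext => z.
    rewrite (coord_ftD _ (tube_slab f2) (tube_slab h2)).
    by rewrite -(coord_ft_ibp _ (tube_slab g2)) -(coord_ft_ibp _ (tube_slab f2)).
  have c1 := tube_coord_ft f2.
  have c2 : slab j0 (fun y => (y 0 j2)%:C * coord_ft j2 f y).
    split; last by apply: vanishMl; exact: c1.2.
    have -> : (fun y : 'rV[R]_4 => (y 0 j2)%:C * coord_ft j2 f y) =
        coord_ft j2 (fun y => 'i%C * pder j2 f y).
      by apply/funext => z; rewrite coord_ft_ibp//; exact: tube_slab.
    by apply: bsmooth_coord_ft; exact: tube_slab.
  have c3 : slab j0 (fun y => (y 0 j2)%:C * ((y 0 j2)%:C * coord_ft j2 f y)).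
    split; last by do 2 apply: vanishMl; exact: c1.2.
    have -> : (fun y : 'rV[R]_4 => (y 0 j2)%:C * ((y 0 j2)%:C * coord_ft j2 f y)) =
        coord_ft j2 h.
      apply/funext => z.
      by rewrite -(coord_ft_ibp _ (tube_slab g2)) -(coord_ft_ibp _ (tube_slab f2)).
    by apply: bsmooth_coord_ft; exact: tube_slab.
  rewrite (coord_ftD _ c1 c3) (coord_ft_coordM _ _ c2)// (coord_ft_coordM _ _ c1)//.
  rewrite /y upd_other// upd_same /oneDsqr rmorphD rmorphXn/=; ring.
rewrite Normc.normcM normc_real ger0_norm// => hle.
by rewrite mulrA /wt ler_pdivlMr// mulrC.
Qed.

Lemma coord_cexp (a b : R) (x : 'rV[R]_4) :
  cexp ('i%C * (Re ((a +i* b) * (coord1 x)^*%C))%:C) = cis (a * x 0 j0) * cis (b * x 0 j2).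
Proof. by rewrite cexp_i reM/= -cisD mulrN opprK. Qed.

Lemma Fz_inv_coord_ft f : tube f ->
  Fz_inv f = (fun x => ((2 * pi)^-1)%:C * coord_ft j0 (coord_ft j2 f) x) /\
  forall x, cintegrable (Fz_inv_integrand f x).
Proof.
move=> f2; have [C hC] := tube_wt f2.
have [fs _ _] := f2.
pose G x (p : R * R) := cis (p.1 * x 0 j0) * cis (p.2 * x 0 j2) * f (upd j0 p.1 (upd j2 p.2 x)).
have GE x : (fun p : R * R => Fz_inv_integrand f x (p.1 +i* p.2)) = G x.
  by apply/funext => p; rewrite /Fz_inv_integrand coord_cexp point_upd.
have main x : [/\ cintble leb2 (G x), forall s, cintble leb (fun t => G x (s, t)) &
      forall t, cintble leb (fun s => G x (s, t))].
  apply: (@plane_integrable _ _ C).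
  - move=> s; rewrite /G/=; apply: ccontinuousM.
      by apply: ccontinuousM; [exact: ccontinuous_cst|exact: ccontinuous_cis].
    under eq_fun do rewrite updC//; exact: bsmooth_upd_ccontinuous.
  - move=> t; rewrite /G/=; apply: ccontinuousM; last exact: bsmooth_upd_ccontinuous.
    by apply: ccontinuousM; [exact: ccontinuous_cis|exact: ccontinuous_cst].
  - by move=> s t; rewrite !Normc.normcM !normc_cis !mul1r.
split; last first.
  move=> x; have [h _ _] := main x.
  rewrite /cintegrable.
  rewrite -/(cintble leb2 (fun p : R * R => Fz_inv_integrand f x (p.1 +i* p.2))).
  by rewrite GE.
apply/funext => x; rewrite /Fz_inv; congr (_ * _).
rewrite -[cintegral _]/(cint leb2 (fun p : R * R => Fz_inv_integrand f x (p.1 +i* p.2))) GE.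
have [h1 h2 h3] := main x.
rewrite (cint_prod12 h1 h2); apply: eq_cint => s.
rewrite /coord_ft_integrand /coord_ft -cintZ; last by apply: coord_ft_cintble; exact: tube_slab.
by apply: eq_cint => t; rewrite /G/= /coord_ft_integrand upd_other// updC// mulrA.
Qed.

(** The two-dimensional inversion is the composition of the inversions in the
    coordinates 0 and 2. *)
Lemma Fz_inversion f x : tube f ->
  cintegrable (Fz_integrand (Fz_inv f) x) /\ Fz (Fz_inv f) x = f x.
Proof.
move=> f2; have [C hC] := coord_ft2_wt f2.
have [e _] := Fz_inv_coord_ft f2.
pose g := coord_ft j0 (coord_ft j2 f).
have gs : bsmooth g by apply: bsmooth_coord_ft; exact: tube_coord_ft.
pose c := ((2 * pi)^-1)%:C : R[i].
pose G (p : R * R) := cis (- (x 0 j0 * p.1)) * cis (- (x 0 j2 * p.2)) *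
  g (upd j0 p.1 (upd j2 p.2 x)).
have GE : (fun p : R * R => Fz_integrand (Fz_inv f) x (p.1 +i* p.2)) = (fun p => c * G p).
  apply/funext => p; rewrite /Fz_integrand e point_upd.
  have -> : cexp (- ('i%C * (Re (coord1 x * (p.1 +i* p.2)^*%C))%:C)) =
    cis (- (x 0 j0 * p.1)) * cis (- (x 0 j2 * p.2)).
    by rewrite -mulrN -rmorphN cexp_i reM/= -cisD mulrN opprK opprD.
  by rewrite mulrCA.
have cisN (a : R) : ccontinuous (fun s => cis (- (a * s))).
  have -> : (fun s : R => cis (- (a * s))) = (fun s => cis (s * (- a))).
    by apply/funext => s; rewrite mulrN mulrC.
  exact: ccontinuous_cis.
have [h1 h2 h3] : [/\ cintble leb2 G, forall s, cintble leb (fun t => G (s, t)) &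
      forall t, cintble leb (fun s => G (s, t))].
  apply: (@plane_integrable _ _ C).
  - move=> s; rewrite /G/=; apply: ccontinuousM.
      by apply: ccontinuousM; [exact: ccontinuous_cst|exact: cisN].
    under eq_fun do rewrite updC//; exact: bsmooth_upd_ccontinuous.
  - move=> t; rewrite /G/=; apply: ccontinuousM; last exact: bsmooth_upd_ccontinuous.
    by apply: ccontinuousM; [exact: cisN|exact: ccontinuous_cst].
  - by move=> s t; rewrite !Normc.normcM !normc_cis !mul1r.
have icG := cintbleZ c h1.
split.
  rewrite /cintegrable -/(cintble leb2 (fun p : R * R => Fz_integrand (Fz_inv f) x (p.1 +i* p.2))).
  by rewrite GE.
rewrite /Fz -[cintegral _]/(cint leb2 (fun p : R * R => Fz_integrand (Fz_inv f) x (p.1 +i* p.2))).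
rewrite GE cintZ// (cint_prod21 h1 h3).
have inner t : cint leb (fun s => G (s, t)) =
    (2 * pi)%:C * (cis (- (x 0 j2 * t)) * coord_ft j2 f (upd j2 t x)).
  have := coord_ft_inversion (upd j2 t x) (tube_coord_ft f2).
  rewrite upd_other// => h.
  rewrite mulrCA -h -cintZ.
    by apply: eq_cint => s; rewrite /G/= -/g mulrA [cis (- (x 0 j2 * t)) * _]mulrC.
  have -> : (fun p => cis (- (x 0 j0 * p)) * coord_ft j0 (coord_ft j2 f) (upd j0 p (upd j2 t x))) =
    (fun s => cis (x 0 j2 * t) * G (s, t)).
    have cc : cis (x 0 j2 * t) * cis (- (x 0 j2 * t)) = 1 by rewrite -cisD subrr cis0.
    by apply/funext => s; rewrite -[LHS]mul1r -cc /G /g/=; ring.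
  exact: (cintbleZ (cis (x 0 j2 * t)) (h3 t)).
rewrite [X in _ * (_ * X)](_ : _ = cint leb (fun t =>
    (2 * pi)%:C * (cis (- (x 0 j2 * t)) * coord_ft j2 f (upd j2 t x)))); last exact: eq_cint.
rewrite cintZ; last first.
  apply: cintble_wbounded; last first.
    have [D hD] := coord_ft_wt (tube_slab f2).
    by exists D => t; rewrite Normc.normcM normc_cis mul1r.
  apply: ccontinuous_cmeasurable; apply: ccontinuousM; first exact: cisN.
  by apply: bsmooth_upd_ccontinuous; apply: bsmooth_coord_ft; exact: tube_slab.
rewrite (coord_ft_inversion x (tube_slab f2)) -/c.
have cK y : c * ((2 * pi)%:C * y) = y.
  by rewrite mulrA /c -rmorphM/= mulVf ?mul1r// mulf_neq0// gt_eqF// pi_gt0.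
by rewrite cK; exact: cK.
Qed.

End partial_fourier.

(** * Rules for the partial Fourier transform; test functions *)

Section partial_fourier_rules.
Variable R : realType.
Implicit Types (x : 'rV[R]_4) (j k : 'I_4) (f g : 'rV[R]_4 -> R[i]).
Local Notation Re := (@complex.Re R).
Local Notation Im := (@complex.Im R).
Local Notation normc := (@Normc.normc R).
Local Notation leb := (@lebesgue_measure R).
Local Notation leb2 := (leb \x leb)%E.
Local Notation j0 := (0 : 'I_4).
Local Notation j2 := (2%R : 'I_4).

(** The operation on the frequency side that corresponds to the k-th partial
    derivative of the inverse transform. *)
Definition symb k f : 'rV[R]_4 -> R[i] :=
  if (k == j0) || (k == j2) then (fun y : 'rV[R]_4 => 'i%C * ((y 0 k)%:C * f y)) else pder k f.

Lemma tube_symb k f : tube f -> tube (symb k f).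
Proof.
move=> h; rewrite /symb; case: ifPn => hk; last exact: tube_pder.
exact/tubeZ/tube_coordM.
Qed.

Lemma pder_Fz_inv k f : tube f -> pder k (Fz_inv f) = Fz_inv (symb k f).
Proof.
move=> f2; have [-> _] := Fz_inv_coord_ft f2; have [-> _] := Fz_inv_coord_ft (tube_symb k f2).
have c2 := tube_slab f2; have e2 := tube_coord_ft f2.
have [fs v0 v2] := f2.
apply/funext => x.
have [_ ->] := pderZ ((2 * pi)^-1)%:C (@bsmooth_pdiff _ _ x k (bsmooth_coord_ft e2)).
congr (_ * _); rewrite /symb.
have [->|k0] := eqVneq k j0.
  have [_ ->] := pder_coord_ft_same x e2; congr (coord_ft _ _ x); apply/funext => y.
  rewrite (coord_ftZ _ _ (f := fun y : 'rV[R]_4 => (y 0 j0)%:C * f y)) ?coord_ft_coordM//.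
  by split; [exact: bsmooth_coordM|exact: vanishMl].
have [_ ->] := pder_coord_ft_other x k0 e2; congr (coord_ft _ _ x); apply/funext => y.
have [->|k2] /= := eqVneq k j2; first by have [] := pder_coord_ft_same y c2.
by have [] := pder_coord_ft_other y k2 c2.
Qed.

Lemma pders_Fz_inv s f : tube f -> pders s (Fz_inv f) = Fz_inv (foldr symb f s).
Proof.
move=> f2; suff : pders s (Fz_inv f) = Fz_inv (foldr symb f s) /\ tube (foldr symb f s).
  by case.
elim: s => //= k s [-> h]; split; first exact: pder_Fz_inv.
exact: tube_symb.
Qed.

Lemma tube_foldr_symb s f : tube f -> tube (foldr symb f s).
Proof. by move=> f2; elim: s => //= k s; exact: tube_symb. Qed.

Lemma coord_Fz_inv k f x : (k == j0) || (k == j2) -> tube f ->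
  (x 0 k)%:C * Fz_inv f x = Fz_inv (fun y => 'i%C * pder k f y) x.
Proof.
move=> hk f2; have g2 : tube (fun y => 'i%C * pder k f y) by exact/tubeZ/tube_pder.
have [-> _] := Fz_inv_coord_ft f2; have [-> _] := Fz_inv_coord_ft g2.
have c2 := tube_slab f2; have e2 := tube_coord_ft f2; have d2 := tube_slab (tube_pder k f2).
rewrite mulrCA; congr (_ * _); case/orP: hk => /eqP hk; subst k.
  rewrite coord_ft_ibp//; congr (coord_ft _ _ x); apply/funext => y.
  by have [_ ->] := pder_coord_ft_other y (isT : j0 != j2) c2; rewrite coord_ftZ.
rewrite -coord_ft_coordM//; congr (coord_ft _ _ x); apply/funext => y; exact: coord_ft_ibp.
Qed.

Lemma bsmooth_Fz_inv f : tube f -> bsmooth (Fz_inv f).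
Proof.
move=> f2; have [-> _] := Fz_inv_coord_ft f2.
exact/bsmoothZ/bsmooth_coord_ft/tube_coord_ft.
Qed.

Lemma bsmooth_smooth_on U f : bsmooth f -> smooth_on U f.
Proof.
move=> fs s x _.
have gs : bsmooth (pders s f) by elim: s => [|k s IH]; [exact: fs|exact: bsmooth_pder IH].
have [c1 c2] := bsmooth_continuous gs.
split; [exact: c1|exact: c2|move=> j|move=> j].
  by have [] := bsmooth_pdiff x j gs.
by have [] := bsmooth_pdiff x j gs.
Qed.

(** Linear combinations of functions with a partial Fourier transform are easier to
    handle when integrability and value are kept together. *)
Definition hasFz g x (v : R[i]) : Prop :=
  cintegrable (Fz_integrand g x) /\ Fz g x = v.

Lemma hasFz_inv f x : tube f -> hasFz (Fz_inv f) x (f x).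
Proof. exact: Fz_inversion. Qed.

Lemma eq_hasFz g h x v : g =1 h -> hasFz g x v -> hasFz h x v.
Proof. by move=> /funext ->. Qed.

Lemma hasFzD g h x u v : hasFz g x u -> hasFz h x v ->
  hasFz (fun y => g y + h y) x (u + v).
Proof.
move=> [gi <-] [hi <-].
have e z : Fz_integrand (fun y => g y + h y) x z =
    Fz_integrand g x z + Fz_integrand h x z by rewrite /Fz_integrand mulrDr.
rewrite /hasFz /Fz (funext e) -mulrDr; split; first exact: (cintbleD (mu := leb2) gi hi).
congr (_ * _); exact: (cintD (mu := leb2) gi hi).
Qed.

(** Functions of w alone are constants for the partial Fourier transform. *)
Lemma hasFzM (c : 'rV[R]_4 -> R[i]) g x v :
  (forall z, c (Defs.point z (coord2 x)) = c x) ->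
  hasFz g x v -> hasFz (fun y => c y * g y) x (c x * v).
Proof.
move=> hc [gi <-].
have e z : Fz_integrand (fun y => c y * g y) x z = c x * Fz_integrand g x z.
  by rewrite /Fz_integrand hc mulrCA.
rewrite /hasFz /Fz (funext e) mulrCA; split; first exact: (cintbleZ (mu := leb2) (c x) gi).
congr (_ * _); exact: (cintZ (mu := leb2) (c x) gi).
Qed.

Lemma hasFz0 x : hasFz (fun=> 0) x 0.
Proof.
have e z : Fz_integrand (fun=> 0) x z = 0 by rewrite /Fz_integrand mulr0.
rewrite /hasFz /Fz (funext e); split.
  split; exact: integrable0.
by rewrite [cintegral _](@cint0 _ _ R leb2) mulr0.
Qed.

Lemma hasFz_sum (I : Type) (r : seq I) (g : I -> 'rV[R]_4 -> R[i]) x (v : I -> R[i]) :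
  (forall i, hasFz (g i) x (v i)) ->
  hasFz (fun y => \sum_(i <- r) g i y) x (\sum_(i <- r) v i).
Proof.
move=> h; elim: r => [|i r IH].
  by under eq_fun do rewrite big_nil; rewrite big_nil; exact: hasFz0.
by under eq_fun do rewrite big_cons; rewrite big_cons; exact: hasFzD.
Qed.

End partial_fourier_rules.

Section test_functions.
Variable R : realType.
Implicit Types (x : 'rV[R]_4) (j k : 'I_4) (f g : 'rV[R]_4 -> R[i]).
Local Notation Re := (@complex.Re R).
Local Notation Im := (@complex.Im R).
Local Notation normc := (@Normc.normc R).

(** Continuity is only asked at the points of the compact set, as in the definition
    of a test function. *)
Lemma compact_continuous_bounded (K : set 'rV[R]_4) (g : 'rV[R]_4 -> R) :
  compact K -> (forall x, K x -> {for x, continuous g}) ->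
  exists B, forall x, K x -> `|g x| <= B.
Proof.
move=> cK cg.
have cgK : {within K, continuous g}.
  by apply: continuous_in_subspaceT => x /set_mem; exact: cg.
have /compact_bounded[M [_ hM]] := continuous_compact cgK cK.
exists (M + 1) => x Kx; apply: (hM (M + 1)); first by rewrite ltrDl.
by exists x.
Qed.

Variables (U : set 'rV[R]_4) (f : 'rV[R]_4 -> R[i]).
Hypothesis ft : test_function U f.

Let supp := closure [set x | f x != 0].

Let near_out x : ~ supp x -> \forall y \near x, ~ supp y.
Proof.
move=> nx; have : open (~` supp) by apply: closed_openC; exact: closed_closure.
by rewrite openE => /(_ x nx).
Qed.

Let out0 x : ~ supp x -> f x = 0.
Proof. by move=> nx; apply: contrapT => /eqP fx; apply: nx; exact: subset_closure. Qed.

Let pders_out s x : ~ supp x -> pders s f x = 0.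
Proof.
elim: s x => [|k s IH] x nx /=; first exact: out0.
by apply: pder_near0; apply: filterS (near_out nx) => y; exact: IH.
Qed.

(** Outside its support the function vanishes near each point, so it is smooth on
    the whole space, not only on the given open set. *)
Lemma test_function_tube : tube f.
Proof.
have [fs cK KU] := ft.
have vf k : vanish k f.
  have [B hB] := @compact_continuous_bounded supp (fun x => x 0 k) cK
    (fun x _ => @coord_continuous _ _ _ _ _ x).
  exists B => x Bx; apply: out0 => /hB; by rewrite leNgt Bx.
split => // s; split.
  have [B1 h1] := @compact_continuous_bounded supp (fun x => Re (pders s f x)) cK
    (fun x Kx => let: And4 h _ _ _ := fs s x (KU x Kx) in h).
  have [B2 h2] := @compact_continuous_bounded supp (fun x => Im (pders s f x)) cK
    (fun x Kx => let: And4 _ h _ _ := fs s x (KU x Kx) in h).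
  exists (`|B1| + `|B2|) => x.
  have [Kx|nKx] := pselect (supp x).
    apply: le_trans (normc_le _) _; apply: lerD.
      exact: le_trans (h1 x Kx) (ler_norm _).
    exact: le_trans (h2 x Kx) (ler_norm _).
  by rewrite pders_out// Normc.normc0 addr_ge0.
move=> x j; have [Kx|nKx] := pselect (supp x).
  by have [_ _ h3 h4] := fs s x (KU x Kx); split; [exact: h3|exact: h4].
have z : \forall y \near x, pders s f y = 0.
  by apply: filterS (near_out nKx) => y; exact: pders_out.
split.
  apply: (@near_eq_derivable _ _ _ (cst 0)); last exact: derivable_cst.
  by apply: filterS z => y ->.
apply: (@near_eq_derivable _ _ _ (cst 0)); last exact: derivable_cst.
by apply: filterS z => y ->.
Qed.

End test_functions.

(** * The complex exponential series *)

Section exponential_series.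
Variable R : realType.
Local Notation Re := (@complex.Re R).
Local Notation Im := (@complex.Im R).
Local Notation normc := (@Normc.normc R).
Implicit Types z : R[i].

(** The norm of R[i] takes its values in R[i], so that the positive numbers in
    the definition of its topology are the embedded positive reals. *)
Lemma ccvg_cvg (u : nat -> R[i]) (l : R[i]) : ccvg u l ->
  (u : nat -> R[i]^o) @ \oo --> (l : R[i]^o).
Proof.
move=> [h1 h2]; apply/cvgrPdist_le => /= e e0.
have [eI eR] : Im e = 0 /\ 0 < Re e.
  by move: e0; rewrite ltcE/= => /andP[/eqP ->].
have eE : e = (Re e)%:C by apply: reimP.
have e2 : 0 < Re e / 2 by rewrite divr_gt0.
have nE (y : R[i]) : `|y| = (normc y)%:C by rewrite normc_def; case: y.
near=> n; rewrite eE [leLHS]nE lecR.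
apply: le_trans (normc_le _) _; rewrite !(reD, imD, reN, imN) [leRHS]splitr.
apply: lerD.
  by near: n; move/cvgrPdist_le: h1; exact.
by near: n; move/cvgrPdist_le: h2; exact.
Unshelve. all: by end_near. Qed.

Definition cexp_sum z (n : nat) : R[i] := \sum_(i < n) z ^+ i / i`!%:R.

Lemma cderive_cexp z t : cderive (fun t => cexp (t%:C * z)) t (z * cexp (t%:C * z)).
Proof.
have h1 : is_derive t (1:R) (fun t => expR (Re z * t)) (Re z * expR (Re z * t)).
  apply: (@is_derive_eq _ _ _ (expR \o (Re z *: id))).
  by rewrite /GRing.scale/= mulr1 mulrC.
have h2 : is_derive t (1:R) (fun t => Im z * t) (Im z).
  apply: (@is_derive_eq _ _ _ (Im z *: id)).
  by rewrite /GRing.scale/= mulr1.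
have e s : cexp (s%:C * z) = (expR (Re z * s))%:C * cis (Im z * s).
  by rewrite cexp_real_imag reM imM re_real im_real !mul0r subr0 addr0 ![s * _]mulrC.
under eq_fun do rewrite e; rewrite e.
have := cderiveM (cderive_real h1) (cderive_cis h2).
move=> /cderive_eq; apply.
rewrite rmorphM/= -mulrA.
by rewrite [X in _ = X * _](complexE z); ring.
Qed.

Lemma cderive_pow n t : cderive (fun t : R => t%:C ^+ n.+1) t (n.+1%:R * t%:C ^+ n).
Proof.
have h : is_derive t (1:R) (fun t => t ^+ n.+1) (n.+1%:R * t ^+ n).
  apply: DeriveDef; first exact: exprn_derivable.
  by rewrite exp_derive /GRing.scale/= mulr1.
have := cderive_real h; rewrite rmorphM/= rmorph_nat rmorphXn/=.
by under eq_fun do rewrite rmorphXn/=.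
Qed.

Lemma cderive_cexp_sum z n t : cderive (fun t => cexp_sum (t%:C * z) n.+1) t
  (z * cexp_sum (t%:C * z) n).
Proof.
elim: n => [|n IH].
  rewrite /cexp_sum big_ord0 mulr0.
  have -> : (fun t => \sum_(i < 1) (t%:C * z) ^+ i / i`!%:R) = fun=> 1 :> R[i].
    by apply/funext => s; rewrite big_ord1 expr0 fact0 divr1.
  exact: cderive_cst.
have -> : (fun t => cexp_sum (t%:C * z) n.+2) =
    (fun t => cexp_sum (t%:C * z) n.+1 + t%:C ^+ n.+1 * (z ^+ n.+1 / n.+1`!%:R)).
  by apply/funext => s; rewrite /cexp_sum big_ord_recr/= exprMn mulrA.
have := cderiveD IH (cderiveM (cderive_pow n t) (cderive_cst (z ^+ n.+1 / n.+1`!%:R) t)).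
move=> /cderive_eq; apply.
rewrite mulr0 addr0 /cexp_sum [in RHS]big_ord_recr/= mulrDr; congr (_ + _).
rewrite factS natrM exprMn exprS.
have n1 : n.+1%:R != 0 :> R[i] by rewrite pnatr_eq0.
have n2 : n`!%:R != 0 :> R[i] by rewrite pnatr_eq0 -lt0n fact_gt0.
by field; rewrite n2 nat1r n1.
Qed.

(** Let S_n be the n-th partial sum.  The function u t = cexp (- t z) S_n (t z)
    equals 1 at 0, and its derivative telescopes to
    - z cexp (- t z) (t z)^n / n!, which tends to 0 uniformly on [0, 1]. *)
Lemma cexp_sum_cvg z : ccvg (cexp_sum z) (cexp z).
Proof.
pose u n (t : R) := cexp (t%:C * (- z)) * cexp_sum (t%:C * z) n.+1.
pose u' n (t : R) := - (z * cexp (t%:C * (- z)) * ((t%:C * z) ^+ n / n`!%:R)).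
have du n t : cderive (u n) t (u' n t).
  have := cderiveM (cderive_cexp (- z) t) (cderive_cexp_sum z n t).
  move=> /cderive_eq; apply.
  by rewrite /u' /cexp_sum big_ord_recr/=; ring.
(* bounds the derivative of u n on [-1, 1] *)
pose b n := normc z * expR `|Re z| * exp_coeff (normc z) n.
have bn n t : `|t| <= `|1 : R| -> normc (u' n t) <= b n.
  rewrite normr1 => t1; rewrite /u' -mulN1r !Normc.normcM.
  have -> : normc (-1) = 1 by rewrite -[-1](rmorphN1 (real_complex R)) normc_real normrN1.
  rewrite mul1r /b; apply: ler_pM; rewrite ?mulr_ge0 ?normc_ge0//.
    apply: ler_wpM2l; first exact: normc_ge0.
    rewrite -/(cis _) normc_cis mulr1 normc_real ger0_norm ?expR_ge0//.
    rewrite ler_expR reM re_real im_real mul0r subr0 reN mulrN.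
    apply: le_trans (ler_norm _) _; rewrite normrN normrM.
    by rewrite ler_piMl.
  rewrite /exp_coeff/= Normc.normcV.
  have -> : normc n`!%:R = n`!%:R.
    by rewrite -(rmorph_nat (real_complex R)) normc_real ger0_norm.
  apply: ler_wpM2r; first by rewrite invr_ge0.
  have normcX (y : R[i]) k : normc (y ^+ k) = normc y ^+ k.
    by elim: k => [|k IH]; rewrite ?expr0 ?Normc.normc1// !exprS Normc.normcM IH.
  rewrite normcX; apply: lerXn2r; rewrite ?nnegrE ?normc_ge0//.
  by rewrite Normc.normcM normc_real ler_piMl// normc_ge0.
have u0 n : u n 0 = 1.
  rewrite /u !mul0r cexp0 mul1r /cexp_sum big_ord_recl expr0 fact0 divr1.
  by rewrite big1 ?addr0// => i _; rewrite /= exprS !mul0r.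
have b0 : b n @[n --> \oo] --> 0.
  rewrite -(mulr0 (normc z * expR `|Re z|)).
  apply: cvgM; first exact: cvg_cst.
  exact/cvg_series_cvg_0/is_cvg_series_exp_coeff.
have lim : ccvg (fun n => u n 1 - 1) 0.
  apply: (@ccvg_normc0 _ _ (fun n => b n + b n)); last first.
    by rewrite -(addr0 0); exact: cvgD.
  move=> n; apply: le_trans (normc_le _) _.
  rewrite -(u0 n) !(reD, imD, reN, imN); apply: lerD.
    have := @mvt_abs _ (fun t => Re (u n t)) (fun t => Re (u' n t)) (b n) 1.
    rewrite normr1 mulr1; apply.
      by move=> t; have [] := du n t.
    by move=> t t1; apply: le_trans (re_le_normc _) (bn _ _ _); rewrite normr1.
  have := @mvt_abs _ (fun t => Im (u n t)) (fun t => Im (u' n t)) (b n) 1.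
  rewrite normr1 mulr1; apply.
    by move=> t; have [] := du n t.
  by move=> t t1; apply: le_trans (im_le_normc _) (bn _ _ _); rewrite normr1.
have main : ccvg (fun n => cexp_sum z n.+1) (cexp z).
  have -> : (fun n => cexp_sum z n.+1) = (fun n => cexp z * (u n 1 - 1) + cexp z).
    apply/funext => n; rewrite /u !mul1r mulrBr mulr1 subrK mulrA -cexpD subrr cexp0.
    by rewrite mul1r.
  rewrite -[X in ccvg _ X]add0r -[X in ccvg _ (X + _)](mulr0 (cexp z)).
  by apply: ccvgD; [apply: ccvgM => //; exact: ccvg_cst|exact: ccvg_cst].
have [m1 m2] := main; split.
  by rewrite -(cvg_shiftS (fun n => Re (cexp_sum z n))).
by rewrite -(cvg_shiftS (fun n => Im (cexp_sum z n))).
Qed.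

End exponential_series.

(** * Derivatives of the Hamiltonian and powers of the bracket *)

Section hamiltonian_derivatives.
Variable R : realType.
Implicit Types (x y : 'rV[R]_4) (i j k : 'I_4) (f g : 'rV[R]_4 -> R[i]).
Local Notation Re := (@complex.Re R).
Local Notation Im := (@complex.Im R).
Local Notation j0 := (0 : 'I_4).
Local Notation j1 := (1 : 'I_4).
Local Notation j2 := (2%R : 'I_4).
Local Notation j3 := (3%R : 'I_4).

(** The k-th partial derivative of [coord1], that is of z or xi. *)
Definition dcoord1 k : R[i] := (k == j0)%:R + 'i%C * (k == j2)%:R.
(** The k-th partial derivative of [coord2], that is of w. *)
Definition dcoord2 k : R[i] := (k == j1)%:R + 'i%C * (k == j3)%:R.

Lemma pder_coord_pair a b x k :
  cderive (fun s => ((x + s *: evec R k) 0 a)%:C + 'i%C * ((x + s *: evec R k) 0 b)%:C) 0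
    ((a == k)%:R + 'i%C * (b == k)%:R).
Proof.
have [p1 e1] := pder_coord x k a; have [p2 e2] := pder_coord x k b.
have := cderiveD (pdiff_cderive p1) (cderiveM (cderive_cst 'i%C 0) (pdiff_cderive p2)).
by rewrite e1 e2 mul0r add0r.
Qed.

Lemma coord1E x : coord1 x = (x 0 j0)%:C + 'i%C * (x 0 j2)%:C.
Proof. by rewrite [LHS]complexE. Qed.

Lemma cderive_coord1 x k : cderive (fun s => coord1 (x + s *: evec R k)) 0 (dcoord1 k).
Proof.
under eq_fun do rewrite coord1E.
by rewrite /dcoord1 ![k == _]eq_sym; exact: pder_coord_pair.
Qed.

Lemma cderive_conj (u : R -> R[i]) t d : cderive u t d ->
  cderive (fun s => (u s)^*%C) t d^*%C.
Proof.
move=> [h1 h2]; split.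
  by under eq_fun do rewrite re_conj; rewrite re_conj.
by under eq_fun do rewrite im_conj; rewrite im_conj; exact: is_deriveN.
Qed.

Lemma cderive_exp2 x k : cderive (fun s => cexp (coord2 (x + s *: evec R k))) 0
  (dcoord2 k * cexp (coord2 x)).
Proof.
have e s : cexp (coord2 (x + s *: evec R k)) =
    (expR (x 0 j1 + s * (j1 == k)%:R))%:C * cis (x 0 j3 + s * (j3 == k)%:R).
  by rewrite cexp_real_imag /= !line_coord.
have h a : is_derive (0 : R) (1:R) (fun s => x 0 a + s * (a == k)%:R) (a == k)%:R.
  exact: is_derive_affine.
have h1 : is_derive (0 : R) (1:R) (fun s => expR (x 0 j1 + s * (j1 == k)%:R))
    ((j1 == k)%:R * expR (x 0 j1)).
  have := h j1 => hj.
  apply: (@is_derive_eq _ _ _ (expR \o (fun s => x 0 j1 + s * (j1 == k)%:R))).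
  by rewrite mul0r addr0 /GRing.scale/= mulrC.
under eq_fun do rewrite e.
have := cderiveM (cderive_real h1) (cderive_cis (h j3)).
move=> /cderive_eq; apply.
rewrite cexp_real_imag /= !mul0r !addr0 /dcoord2 ![k == _]eq_sym rmorphM/= !rmorph_nat; ring.
Qed.

(** A family containing the Hamiltonians and stable under partial derivatives. *)
Definition ham_form (a b c d e : R[i]) y : R[i] :=
  a * coord1 y + b * (coord1 y)^*%C + c * cexp (coord2 y) + d * cexp (coord2 y)^*%C + e.

Lemma pder_ham_form a b c d e k :
  pder k (ham_form a b c d e) =
  ham_form 0 0 (c * dcoord2 k) (d * (dcoord2 k)^*%C) (a * dcoord1 k + b * (dcoord1 k)^*%C).
Proof.
apply/funext => x.
have hz := cderive_coord1 x k; have hw := cderive_exp2 x k.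
have cst1 (c' : R[i]) (u : R -> R[i]) (d' : R[i]) :
    cderive u 0 d' -> cderive (fun s => c' * u s) 0 (c' * d').
  move=> h; have := cderiveM (cderive_cst c' 0) h.
  by rewrite mul0r add0r.
have := cderiveD (cderiveD (cderiveD (cderiveD (cst1 a _ _ hz) (cst1 b _ _ (cderive_conj hz)))
  (cst1 c _ _ hw)) (cst1 d _ _ (cderive_conj hw))) (cderive_cst e 0).
under eq_fun do rewrite -cexp_conj.
move=> /(@pderE _ (ham_form a b c d e))[_ ->].
rewrite /ham_form cexp_conj rmorphM/=; ring.
Qed.

Lemma pders_ham_form a b c d (s : seq 'I_4) :
  pders s (ham_form a b c d 0) =
  ham_form (if s is [::] then a else 0) (if s is [::] then b else 0)
    (c * \prod_(k <- s) dcoord2 k) (d * \prod_(k <- s) (dcoord2 k)^*%C)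
    (if s is [:: k] then a * dcoord1 k + b * (dcoord1 k)^*%C else 0).
Proof.
elim: s => [|k s IH]; first by rewrite !big_nil !mulr1.
rewrite /= -/(pders s _) IH pder_ham_form !big_cons.
rewrite -!mulrA ![_ * dcoord2 k]mulrC ![_ * (dcoord2 k)^*%C]mulrC.
by case: s {IH} => [//|l s]; rewrite !mul0r add0r.
Qed.

Lemma hamiltonianE (A : 'M[R[i]]_2) :
  hamiltonian A =
  ham_form (2^-1 * A 0 0) (2^-1 * (A 0 0)^*%C) (2^-1 * A 0 1) (2^-1 * (A 0 1)^*%C) 0.
Proof. by apply/funext => y; rewrite /hamiltonian /ham_form; ring. Qed.

End hamiltonian_derivatives.

Section poisson_powers.
Variable R : realType.
Implicit Types (x y : 'rV[R]_4) (i j k : 'I_4) (f g : 'rV[R]_4 -> R[i]).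

Local Notation j0 := (0 : 'I_4).
Local Notation j1 := (1 : 'I_4).
Local Notation j2 := (2%R : 'I_4).
Local Notation j3 := (3%R : 'I_4).

(** Row i of the matrix of the bracket has a single nonzero entry, in this column. *)
Definition wedge_col i : 'I_4 := nth j0 [:: j1; j0; j3; j2] i.
Definition wedge_sign i : R[i] := nth 0 [:: 1; -1; -1; 1] i.

Lemma wedgeE i j : wedge R i j = wedge_sign i * (j == wedge_col i)%:R.
Proof.
rewrite /wedge mxE /wedge_sign /wedge_col.
case: i => [[|[|[|[|//]]]] hi]; case: j => [[|[|[|[|//]]]] hj];
  by rewrite /= ?mulr1 ?mulr0 ?mulrN1.
Qed.

(** Since each row of [wedge] has one nonzero entry, the indices I determine J. *)
Lemma PrE r f g y : Pr r f g y =
  \sum_(I : r.-tuple 'I_4)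
    (\prod_(k <- I) wedge_sign k) * pders I f y * pders (map wedge_col I) g y.
Proof.
apply: eq_bigr => I _.
rewrite (bigD1 [tuple of map wedge_col I])//= [X in _ + X]big1 ?addr0.
  congr (_ * _ * _); rewrite big_tuple; apply: eq_bigr => s _.
  by rewrite wedgeE tnth_map eqxx mulr1.
move=> J JI.
have [s hs] : exists s, tnth J s != wedge_col (tnth I s).
  apply/existsP; rewrite -negb_forall; apply: contra JI => /forallP h.
  by apply/eqP/eq_from_tnth => s; rewrite tnth_map; apply/eqP.
by rewrite (bigD1 s)//= wedgeE (negbTE hs) mulr0 !mul0r.
Qed.

(** This is what turns the sum over multi-indices into the r-th power of a first
    order operator. *)
Lemma sum_tuple_prod r (h : 'I_4 -> R[i]) :
  \sum_(I : r.-tuple 'I_4) \prod_(k <- I) h k = (\sum_k h k) ^+ r.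
Proof.
transitivity (\prod_(s < r) \sum_k h k); last by rewrite prodr_const card_ord.
rewrite bigA_distr_bigA/=.
rewrite (reindex (fun F : {ffun 'I_r -> 'I_4} => [tuple F s | s < r])); last first.
  exists (fun I : r.-tuple 'I_4 => [ffun s => tnth I s]) => [F|I] _.
    by apply/ffunP => s; rewrite ffunE tnth_mktuple.
  by apply/eq_from_tnth => s; rewrite tnth_mktuple ffunE.
by apply: eq_bigr => F _; rewrite big_tuple; apply: eq_bigr => s _; rewrite tnth_mktuple.
Qed.

End poisson_powers.

(** * The partial Fourier transform of the terms of the Moyal product *)

Section star_terms.
Variable R : realType.
Implicit Types (x y : 'rV[R]_4) (i j k : 'I_4) (f g : 'rV[R]_4 -> R[i]).
Local Notation j0 := (0 : 'I_4).
Local Notation j1 := (1 : 'I_4).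
Local Notation j2 := (2%R : 'I_4).
Local Notation j3 := (3%R : 'I_4).

(** The multiplier of [symb (wedge_col k)] for k = 1, 3, the indices for which the
    derivatives of e^w are nonzero. *)
Definition freq x k : R[i] := 'i%C * (x 0 (wedge_col k))%:C.

(** Here d is [dcoord2] or its conjugate: the multi-indices involving derivatives
    in w of the transform contribute 0. *)
Lemma symb_prod (d : 'I_4 -> R[i]) f x (s : seq 'I_4) : d j0 = 0 -> d j2 = 0 ->
  (\prod_(k <- s) d k) * foldr (@symb R) f (map wedge_col s) x =
  (\prod_(k <- s) (d k * freq x k)) * f x.
Proof.
move=> d0 d2; elim: s => [|k s IH]; first by rewrite !big_nil.
rewrite !big_cons /= {1}/symb.
have [->|k0] := eqVneq k j0; first by rewrite d0 !mul0r.
have [->|k2] := eqVneq k j2; first by rewrite d2 !mul0r.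
have -> : (wedge_col k == j0) || (wedge_col k == j2).
  by case: k k0 k2 => [[|[|[|[|//]]]] hk].
rewrite -[RHS]mulrA -IH /freq; ring.
Qed.

Lemma sum_ord4 (F : 'I_4 -> R[i]) : \sum_k F k = F j0 + F j1 + F j2 + F j3.
Proof.
rewrite !big_ord_recl big_ord0 addr0 !addrA.
by congr (F _ + F _ + F _ + F _); apply/val_inj.
Qed.

Lemma coord1_conjE x : (coord1 x)^*%C = (x 0 j0)%:C - 'i%C * (x 0 j2)%:C.
Proof.
apply: reimP; rewrite /coord1 !reimE.
  by rewrite !(mul0r, mul1r, mulr0, subr0, addr0).
by rewrite !(mul0r, mul1r, mulr0, subr0, addr0, add0r).
Qed.

Lemma dcoord2_0 : dcoord2 R j0 = 0. Proof. by rewrite /dcoord2/= mulr0 addr0. Qed.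
Lemma dcoord2_1 : dcoord2 R j1 = 1. Proof. by rewrite /dcoord2/= mulr0 addr0. Qed.
Lemma dcoord2_2 : dcoord2 R j2 = 0. Proof. by rewrite /dcoord2/= mulr0 addr0. Qed.
Lemma dcoord2_3 : dcoord2 R j3 = 'i%C. Proof. by rewrite /dcoord2/= mulr1 add0r. Qed.

Lemma conj_i : 'i%C^*%C = - 'i%C :> R[i].
Proof. by apply: reimP; rewrite /= ?oppr0. Qed.

Lemma freq_sum x :
  \sum_k wedge_sign R k * (dcoord2 R k * freq x k) = - ('i%C * (coord1 x)^*%C).
Proof.
rewrite sum_ord4 dcoord2_0 dcoord2_1 dcoord2_2 dcoord2_3 coord1_conjE.
rewrite /freq -[wedge_col j1]/j0 -[wedge_col j3]/j2 -[wedge_sign R j1]/(-1) -[wedge_sign R j3]/1.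
ring.
Qed.

Lemma freq_conj_sum x :
  \sum_k wedge_sign R k * ((dcoord2 R k)^*%C * freq x k) = - ('i%C * coord1 x).
Proof.
rewrite sum_ord4 dcoord2_0 dcoord2_1 dcoord2_2 dcoord2_3 coord1E conjc0 conjc1 conj_i.
rewrite /freq -[wedge_col j1]/j0 -[wedge_col j3]/j2 -[wedge_sign R j1]/(-1) -[wedge_sign R j3]/1.
ring.
Qed.

Lemma coord2_point (z w : R[i]) : coord2 (Defs.point z w) = w.
Proof. by rewrite /coord2 !mxE/=; case: w. Qed.

Lemma hasFz_coord1 f x : tube f ->
  hasFz (fun y => coord1 y * Fz_inv f y) x ('i%C * (pder j0 f x + 'i%C * pder j2 f x)).
Proof.
move=> f2.
have h k : (k == j0) || (k == j2) ->
    hasFz (fun y => (y 0 k)%:C * Fz_inv f y) x ('i%C * pder k f x).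
  move=> hk; apply: (@eq_hasFz _ (Fz_inv (fun y => 'i%C * pder k f y))).
    by move=> y; rewrite coord_Fz_inv.
  by apply: hasFz_inv; exact/tubeZ/tube_pder.
rewrite mulrDr mulrCA.
apply: (@eq_hasFz _ (fun y => (y 0 j0)%:C * Fz_inv f y +
   (fun=> 'i%C) y * ((y 0 j2)%:C * Fz_inv f y))).
  by move=> y; rewrite coord1E; ring.
by apply: hasFzD; [exact: h|apply: hasFzM => //; exact: h].
Qed.

Lemma hasFz_coord1_conj f x : tube f ->
  hasFz (fun y => (coord1 y)^*%C * Fz_inv f y) x
    ('i%C * (pder j0 f x - 'i%C * pder j2 f x)).
Proof.
move=> f2.
have h k : (k == j0) || (k == j2) ->
    hasFz (fun y => (y 0 k)%:C * Fz_inv f y) x ('i%C * pder k f x).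
  move=> hk; apply: (@eq_hasFz _ (Fz_inv (fun y => 'i%C * pder k f y))).
    by move=> y; rewrite coord_Fz_inv.
  by apply: hasFz_inv; exact/tubeZ/tube_pder.
have -> : 'i%C * (pder j0 f x - 'i%C * pder j2 f x) =
  'i%C * pder j0 f x + (fun=> - 'i%C) x * ('i%C * pder j2 f x) by ring.
apply: (@eq_hasFz _ (fun y => (y 0 j0)%:C * Fz_inv f y +
   (fun=> - 'i%C) y * ((y 0 j2)%:C * Fz_inv f y))).
  by move=> y; rewrite coord1_conjE; ring.
by apply: hasFzD; [exact: h|apply: hasFzM => //; exact: h].
Qed.

Variables (a b c d : R[i]) (f : 'rV[R]_4 -> R[i]).
Hypothesis f2 : tube f.
Local Notation H := (ham_form a b c d 0).

(** Contribution of the part of the Hamiltonian that is linear in z: at order 0 the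
    multiplication by z, at order 1 constant coefficients, nothing beyond. *)
Definition linear_part x (s : seq 'I_4) : R[i] :=
  match s with
  | [::] => a * ('i%C * (pder j0 f x + 'i%C * pder j2 f x)) +
            b * ('i%C * (pder j0 f x - 'i%C * pder j2 f x))
  | [:: k] => (a * dcoord1 R k + b * (dcoord1 R k)^*%C) * symb (wedge_col k) f x
  | _ => 0
  end.

Lemma hasFz_pders s x :
  hasFz (fun y => (\prod_(k <- s) wedge_sign R k) * pders s H y *
    pders (map wedge_col s) (Fz_inv f) y) x
   ((\prod_(k <- s) wedge_sign R k) * (linear_part x s +
      ((c * \prod_(k <- s) dcoord2 R k) * cexp (coord2 x) +
       (d * \prod_(k <- s) (dcoord2 R k)^*%C) * cexp (coord2 x)^*%C ) *
         foldr (@symb R) f (map wedge_col s) x)).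
Proof.
have fs2 := tube_foldr_symb (map wedge_col s) f2.
have hw a' b' e' g v : hasFz g x v ->
    hasFz (fun y => ham_form 0 0 a' b' e' y * g y) x (ham_form 0 0 a' b' e' x * v).
  by apply: hasFzM => z; rewrite /ham_form coord2_point !mul0r.
rewrite pders_ham_form (pders_Fz_inv _ f2).
case: s fs2 => [|k s] fs2.
  set P := \prod_(k <- [::]) _; rewrite !big_nil /=.
  apply: (@eq_hasFz _ (fun y => (fun=> P) y * ((fun=> a) y * (coord1 y * Fz_inv f y) +
     (fun=> b) y * ((coord1 y)^*%C * Fz_inv f y) + ham_form 0 0 (c * 1) (d * 1) 0 y * Fz_inv f y))).
    by move=> y; rewrite /ham_form; ring.
  have -> : c * 1 * cexp (coord2 x) + d * 1 * cexp (coord2 x)^*%C =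
    ham_form 0 0 (c * 1) (d * 1) 0 x by rewrite /ham_form; ring.
  apply: hasFzM => //; apply: hasFzD; last by apply: hw; exact: hasFz_inv.
  apply: hasFzD; apply: hasFzM => //.
    exact: hasFz_coord1.
  exact: hasFz_coord1_conj.
set P := \prod_(k <- _ :: _) wedge_sign R k.
set K := foldr _ _ _ in fs2 *.
set e := (X in ham_form _ _ _ _ X).
have -> : linear_part x (k :: s) = e * K x.
  by rewrite /e /K; case: s {fs2 e K P} => [|l s] //=; rewrite mul0r.
rewrite -mulrDl.
set p := c * _; set q := d * _.
have -> : e + (p * cexp (coord2 x) + q * cexp (coord2 x)^*%C ) = ham_form 0 0 p q e x.
  by rewrite /ham_form; ring.
apply: (@eq_hasFz _ (fun y => (fun=> P) y * (ham_form 0 0 p q e y * Fz_inv K y))).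
  by move=> y; rewrite mulrA.
by apply: hasFzM => //; apply: hw; exact: hasFz_inv.
Qed.

(** By [PrE] a sum over multi-indices of the terms of [hasFz_pders]; the exponential
    parts are summed with [sum_tuple_prod], [freq_sum] and [freq_conj_sum]. *)
Lemma hasFz_Pr r x : hasFz (Pr r H (Fz_inv f)) x
  ((\sum_(I : r.-tuple 'I_4) (\prod_(k <- I) wedge_sign R k) * linear_part x I) +
   (c * cexp (coord2 x) * (- ('i%C * (coord1 x)^*%C )) ^+ r +
    d * cexp (coord2 x)^*%C * (- ('i%C * coord1 x)) ^+ r) * f x).
Proof.
(* the exponential part of the term I is a product over the entries of I *)
have perI (I : r.-tuple 'I_4) : (\prod_(k <- I) wedge_sign R k) * (linear_part x I +
      ((c * \prod_(k <- I) dcoord2 R k) * cexp (coord2 x) +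
       (d * \prod_(k <- I) (dcoord2 R k)^*%C) * cexp (coord2 x)^*%C) *
         foldr (@symb R) f (map wedge_col I) x) =
    (\prod_(k <- I) wedge_sign R k) * linear_part x I +
    (c * cexp (coord2 x) * f x) *
      (\prod_(k <- I) (wedge_sign R k * (dcoord2 R k * freq x k))) +
    (d * cexp (coord2 x)^*%C * f x) *
      (\prod_(k <- I) (wedge_sign R k * ((dcoord2 R k)^*%C * freq x k))).
  have h1 := @symb_prod (dcoord2 R) f x I dcoord2_0 dcoord2_2.
  have h2 := @symb_prod (fun k => (dcoord2 R k)^*%C) f x I.
  rewrite dcoord2_0 dcoord2_2 conjc0 in h2; have {}h2 := h2 erefl erefl.
  rewrite [\prod_(k <- I) (wedge_sign R k * (dcoord2 R k * _))]big_split.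
  rewrite [\prod_(k <- I) (wedge_sign R k * ((dcoord2 R k)^*%C * _))]big_split /=.
  set P := \prod_(k <- I) wedge_sign R k.
  transitivity (P * linear_part x I + P * (c * cexp (coord2 x) *
    ((\prod_(k <- I) dcoord2 R k) * foldr (@symb R) f (map wedge_col I) x)) +
    P * (d * cexp (coord2 x)^*%C *
    ((\prod_(k <- I) (dcoord2 R k)^*%C) * foldr (@symb R) f (map wedge_col I) x))); first by ring.
  by rewrite h1 h2; ring.
have -> : (\sum_(I : r.-tuple 'I_4) (\prod_(k <- I) wedge_sign R k) * linear_part x I) +
   (c * cexp (coord2 x) * (- ('i%C * (coord1 x)^*%C )) ^+ r +
    d * cexp (coord2 x)^*%C * (- ('i%C * coord1 x)) ^+ r) * f x =
   \sum_(I : r.-tuple 'I_4) ((\prod_(k <- I) wedge_sign R k) * (linear_part x I +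
      ((c * \prod_(k <- I) dcoord2 R k) * cexp (coord2 x) +
       (d * \prod_(k <- I) (dcoord2 R k)^*%C) * cexp (coord2 x)^*%C) *
         foldr (@symb R) f (map wedge_col I) x)).
  under [RHS]eq_bigr do rewrite perI.
  rewrite 2!big_split -!mulr_sumr !sum_tuple_prod freq_sum freq_conj_sum.
  by rewrite /=; ring.
apply: (@eq_hasFz _ (fun y => \sum_(I : r.-tuple 'I_4)
   (\prod_(k <- I) wedge_sign R k) * pders I H y * pders (map wedge_col I) (Fz_inv f) y)).
  by move=> y; rewrite PrE.
by apply: hasFz_sum => I; exact: hasFz_pders.
Qed.

End star_terms.

(** * The Moyal series *)

Section star_series.
Variable R : realType.
Implicit Types (x y : 'rV[R]_4) (k : 'I_4).
Local Notation j0 := (0 : 'I_4).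
Local Notation j1 := (1 : 'I_4).
Local Notation j2 := (2%R : 'I_4).
Local Notation j3 := (3%R : 'I_4).

Variables (a b c d : R[i]) (f : 'rV[R]_4 -> R[i]).
Hypothesis f2 : tube f.
Local Notation H := (ham_form a b c d 0).

Definition linear_sum x r : R[i] :=
  \sum_(I : r.-tuple 'I_4) (\prod_(k <- I) wedge_sign R k) * linear_part a b f x I.

Lemma linear_sum0 x : linear_sum x 0 =
  a * ('i%C * (pder j0 f x + 'i%C * pder j2 f x)) +
  b * ('i%C * (pder j0 f x - 'i%C * pder j2 f x)).
Proof.
rewrite /linear_sum (big_pred1 [tuple]) /= ?big_nil ?mul1r//.
by move=> I; rewrite [I]tuple0 /= eqxx.
Qed.

Lemma linear_sum1 x : linear_sum x 1 =
  a * (pder j1 f x - 'i%C * pder j3 f x) + b * (pder j1 f x + 'i%C * pder j3 f x).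
Proof.
rewrite /linear_sum (reindex (fun k => [tuple k])); last first.
  exists (fun I : 1.-tuple 'I_4 => thead I) => [k _|I _]; first by rewrite theadE.
  by case: I => [[|k [|l s]] hs] //; apply/val_inj.
have dcoord1_0 : dcoord1 R j0 = 1 by rewrite /dcoord1/= mulr0 addr0.
have dcoord1_1 : dcoord1 R j1 = 0 by rewrite /dcoord1/= mulr0 addr0.
have dcoord1_2 : dcoord1 R j2 = 'i%C by rewrite /dcoord1/= mulr1 add0r.
have dcoord1_3 : dcoord1 R j3 = 0 by rewrite /dcoord1/= mulr0 addr0.
have lin1 k : linear_part a b f x [tuple k] =
  (a * dcoord1 R k + b * (dcoord1 R k)^*%C) * symb (wedge_col k) f x by [].
rewrite sum_ord4 !big_seq1 !lin1 dcoord1_0 dcoord1_1 dcoord1_2 dcoord1_3 conjc0 conjc1 conj_i.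
rewrite -[wedge_col j0]/j1 -[wedge_col j2]/j3 -[wedge_sign R j0]/1 -[wedge_sign R j2]/(-1).
rewrite /symb /=; ring.
Qed.

Lemma linear_sumSS x r : linear_sum x r.+2 = 0.
Proof.
rewrite /linear_sum big1// => -[[|k [|l s]] hs] _ //=; exact: mulr0.
Qed.

(** The factors (2 i)^-r turn - i conj xi and - i xi into - conj xi / 2 and
    - xi / 2, and the powers sum to exponentials. *)
Definition star_limit x : R[i] :=
  linear_sum x 0 + (2 * 'i%C)^-1 * linear_sum x 1 +
  (c * cexp (coord2 x) * f x * cexp (- (2^-1 * (coord1 x)^*%C)) +
   d * cexp (coord2 x)^*%C * f x * cexp (- (2^-1 * coord1 x))).

Lemma star_terms_cvg x :
  ccvg (fun n => \sum_(r < n) (r`!%:R^-1 * (2 * 'i%C)^-1 ^+ r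
     * Fz (Pr r H (Fz_inv f)) x)) (star_limit x).
Proof.
pose z1 : R[i] := - (2^-1 * (coord1 x)^*%C); pose z2 : R[i] := - (2^-1 * coord1 x).
pose t r := r`!%:R^-1 * (2 * 'i%C)^-1 ^+ r * linear_sum x r.
have i0 : 'i%C != 0 :> R[i] by rewrite eq_complex /= eqxx oner_eq0.
have half u : (2 * 'i%C)^-1 * - ('i%C * u) = - (2^-1 * u) :> R[i] by field.
have term r : r`!%:R^-1 * (2 * 'i%C)^-1 ^+ r * Fz (Pr r H (Fz_inv f)) x =
    t r + ((c * cexp (coord2 x) * f x) * (z1 ^+ r / r`!%:R) +
           (d * cexp (coord2 x)^*%C * f x) * (z2 ^+ r / r`!%:R)).
  have [_ ->] := hasFz_Pr a b c d f2 r x.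
  rewrite /z1 /z2 -!half !exprMn /t -/(linear_sum x r); ring.
have sumE n : \sum_(r < n) (r`!%:R^-1 * (2 * 'i%C)^-1 ^+ r * Fz (Pr r H (Fz_inv f)) x) =
    \sum_(r < n) t r + ((c * cexp (coord2 x) * f x) * cexp_sum z1 n +
           (d * cexp (coord2 x)^*%C * f x) * cexp_sum z2 n).
  under eq_bigr do rewrite term.
  by rewrite !big_split/= -!mulr_sumr.
rewrite (funext sumE); apply: ccvgD; last first.
  by apply: ccvgD; (apply: ccvgM; [exact: ccvg_cst|exact: cexp_sum_cvg]).
have tE n : \sum_(r < n.+2) t r = linear_sum x 0 + (2 * 'i%C)^-1 * linear_sum x 1.
  elim: n => [|n IH].
    by rewrite !big_ord_recl big_ord0 addr0 /t /= expr0 expr1 fact0 factS fact0 !invr1 !mul1r.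
  by rewrite big_ord_recr/= IH /t linear_sumSS mulr0 addr0.
have tN : \forall n \near \oo, \sum_(r < n) t r =
    linear_sum x 0 + (2 * 'i%C)^-1 * linear_sum x 1.
  by exists 2%N => //= -[|[|n]] //= _; exact: tE.
by split; apply: cvg_near_cst; apply: filterS tN => n ->.
Qed.

End star_series.

Theorem proposition3p5 (R : realType) (k : int) (A : 'M[R[i]]_2)
    (f : 'rV[R]_4 -> R[i]) (hA : aff A) (hf : test_function (CH k) f) :
  let alpha := A 0 0 in
  let beta := A 0 1 in
  ell_hat_defined (CH k) A f /\
  forall x : 'rV[R]_4, CH k x ->
    let xi := coord1 x in
    let w := coord2 x in
    ell_hat A f x =
      alpha * (2^-1 * d2 f x - d1bar f x)
      + alpha^*%C * (2^-1 * d2bar f x - d1 f x)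
      + 'i%C / 2 * (beta * cexp (w - 2^-1 * xi^*%C)
                  + beta^*%C * cexp (w^*%C - 2^-1 * xi)) * f x.
Proof.
move=> alpha beta.
have f2 := test_function_tube hf.
pose a := 2^-1 * alpha; pose b := 2^-1 * alpha^*%C.
pose c := 2^-1 * beta; pose d := 2^-1 * beta^*%C.
have HE : hamiltonian A = ham_form a b c d 0 by rewrite hamiltonianE.
have lim x : (star_partial_sums A f x : nat -> R[i]^o) @ \oo -->
    (star_limit a b c d f x : R[i]^o).
  have -> : star_partial_sums A f x =
      (fun n => \sum_(r < n) (r`!%:R^-1 * (2 * 'i%C)^-1 ^+ r
         * Fz (Pr r (ham_form a b c d 0) (Fz_inv f)) x)).
    by apply/funext => n; rewrite /star_partial_sums seriesEord/= -HE.
  exact/ccvg_cvg/star_terms_cvg.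
split.
  split; first exact/bsmooth_smooth_on/bsmooth_Fz_inv.
  move=> x _; split.
  - by have [_] := Fz_inv_coord_ft f2.
  - by move=> r; rewrite HE; have [] := hasFz_Pr a b c d f2 r x.
  - by apply/cvg_ex; exists (star_limit a b c d f x); exact: lim.
move=> x _ xi w.
rewrite /ell_hat (cvg_lim (@norm_hausdorff _ _) (lim x)) /a /b /c /d.
rewrite /star_limit linear_sum0 linear_sum1 !cexpD -/xi -/w /d2 /d2bar /d1 /d1bar.
have i0 : 'i%C != 0 :> R[i] by rewrite eq_complex /= eqxx oner_eq0.
have i2 : 'i%C * 'i%C = -1 :> R[i] by rewrite -expr2 sqr_i.
have half : 'i%C * (2 * 'i%C)^-1 = 2^-1 :> R[i] by field.
set u0 := pder 0 f x; set u1 := pder 1 f x; set u2 := pder 2%R f x; set u3 := pder 3%R f x.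
set e1 := cexp w; set e2 := cexp (- (2^-1 * xi^*%C)); set e3 := cexp (- (2^-1 * xi)).
set e4 := cexp w^*%C.
(* the factors i * i and i * (2 i)^-1 are isolated; the rest is a ring identity *)
transitivity ('i%C * 'i%C *
    (2^-1 * alpha * (u0 + 'i%C * u2) + 2^-1 * alpha^*%C * (u0 - 'i%C * u2)) +
  'i%C * (2 * 'i%C)^-1 *
    (2^-1 * alpha * (u1 - 'i%C * u3) + 2^-1 * alpha^*%C * (u1 + 'i%C * u3)) +
  'i%C * (2^-1 * beta * e1 * f x * e2 + 2^-1 * beta^*%C * e4 * f x * e3)); first by ring.
rewrite i2 half; ring.
Qed.
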